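(* For all integers $n\geq1$, all $1\leq H<\infty$ and all $1<\rho\leq 2$, there exist $\varepsilon_1=\varepsilon_1(n,H,\rho)>0$ and $C_1=C_1(n)>0$ with the following property. If $1\leq n\leq N$, $E\subsetneq \mathbb{R}^n$ is closed, $f:E\rightarrow\mathbb{R}^N$ is nonconstant, and $(f,E,\mathcal{A})$ is $\varepsilon$-almost affine for some $0<\varepsilon\leq \varepsilon_1$ and some $\mathcal{A}=\{A_{x,r}:x\in E,r>0\}$ such that $$\lambda_n(A_{x,r}')\leq H\lambda_1(A_{x,r}')\quad\text{for all }x\in E\text{ and }r>0,$$ then $f$ can be extended to a $C_1\varepsilon$-almost affine map $F:\mathbb{R}^n\rightarrow\mathbb{R}^N$ such that $(F,\mathbb{R}^n,\mathcal{A}^+)$ is $C_1\varepsilon$-almost affine for some $C_1\varepsilon$-compatible family $\mathcal{A}^+=\{A^+_{x,r}:x\in\mathbb{R}^n,r>0\}$ of affine maps over $\mathbb{R}^n$ extending $\mathcal{A}$, i.e. $F|_E=f$ and $A_{x,r}^+=A_{x,r}$ for all $x\in E$ and $r>0$. Moreover, the extension $F$ is weakly $\rho H$-quasisymmetric and the extension $\mathcal{A}^+$ satisfies $$\lambda_n\big((A^+_{x,r})'\big)\leq \frac{\rho+1}{2}H\,\lambda_1\big((A^+_{x,r})'\big)\quad\text{for all }x\in \mathbb{R}^n\text{ and }r>0.$$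
   Context: $B^n(x,r)$ denotes the closed ball in $\mathbb{R}^n$. For an affine map $A:\mathbb{R}^n\to\mathbb{R}^N$ ($n\le N$), $A'$ denotes its linear part, $\|A'\|$ the operator norm, and $\lambda_1(A')\leq\dots\leq\lambda_n(A')$ the singular values of $A'$ (so $\lambda_1(A')=\inf_{|v|=1}|A'v|$ and $\lambda_n(A')=\|A'\|$). A family of affine maps over $E\subset\mathbb{R}^n$ is an indexed set $\mathcal{A}=\{A_{x,r}:x\in E,r>0\}$ of affine maps $A_{x,r}:\mathbb{R}^n\to\mathbb{R}^N$. For $\varepsilon>0$, $\mathcal{A}$ is $\varepsilon$-compatible if $\|A'_{x,r}-A'_{y,s}\|\leq\varepsilon\min\{\|A'_{x,r}\|,\|A'_{y,s}\|\}$ for all $x,y\in E$ and $r,s>0$ with $|x-y|\leq\max\{r,s\}$ and $1/2\leq r/s\leq2$. Let $E\subset X\subset\mathbb{R}^n$ and $\varepsilon>0$. A map $f:X\to\mathbb{R}^N$ is $\varepsilon$-almost affine over $E$ if there is an $\varepsilon$-compatible family $\mathcal{A}$ of affine maps over $E$ such that $\sup_{z\in E\cap B^n(x,r)}|f(z)-A_{x,r}(z)|\leq\varepsilon\|A'_{x,r}\|r$ for all $x\in E$, $r>0$; in this case we say $(f,E,\mathcal{A})$ is $\varepsilon$-almost affine. A map $F:\mathbb{R}^n\to\mathbb{R}^N$ is weakly $H$-quasisymmetric ($1\le H<\infty$) if it is a topological embedding (homeomorphism onto its image) such that for all $a,b,x\in\mathbb{R}^n$, $|a-x|\le|b-x|$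 implies $|F(a)-F(x)|\le H|F(b)-F(x)|$. *)

(* Defs.v *)
From HB Require Import structures.
From mathcomp Require Import all_boot all_order all_algebra.
From mathcomp Require Import polyrcf.
From mathcomp Require Import all_classical all_reals all_analysis.

Set Implicit Arguments.
Unset Strict Implicit.
Unset Printing Implicit Defensive.

Import Order.TTheory GRing.Theory Num.Theory.
Import numFieldNormedType.Exports.

Local Open Scope classical_set_scope.
Local Open Scope ring_scope.

(* Points of R^n are row vectors and a linear map R^n -> R^N is a matrix
   L : 'M_(n, N) acting by v |-> v *m L.  The topology of 'rV[R]_n is the usual
   one, but its library norm `|v| is the sup norm, so distances are measured
   with the Euclidean norm below. *)

Definition enorm (R : realType) (n : nat) (v : 'rV[R]_n) : R :=
  Num.sqrt (\sum_(i < n) v ord0 i ^+ 2).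

Definition eclosed_ball (R : realType) (n : nat) (x : 'rV[R]_n) (r : R) :
  set 'rV[R]_n := [set z | enorm (z - x) <= r].

Definition opnorm (R : realType) (n N : nat) (L : 'M[R]_(n, N)) : R :=
  sup [set enorm (v *m L) | v in [set v : 'rV[R]_n | enorm v <= 1]].

(* The square roots of the eigenvalues of L^* L, in nondecreasing order and with
   multiplicity.  For row vectors L^* L acts as v |-> v *m (L *m L^T); rootsR
   lists the distinct real roots of a polynomial in increasing order. *)
Definition singular_values (R : realType) (n N : nat) (L : 'M[R]_(n, N)) :
  seq R :=
  let p := char_poly (L *m L^T) in
  flatten [seq nseq (mup x p) (Num.sqrt x) | x <- rootsR p].

(* Indices start at 1: singval 1 L is the smallest singular value, and
   singval n L the largest one. *)
Definition singval (R : realType) (n N : nat) (k : nat) (L : 'M[R]_(n, N)) : R :=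
  nth 0 (singular_values L) k.-1.

Record affine_map (R : realType) (n N : nat) := AffineMap {
  linear_part : 'M[R]_(n, N);
  translation : 'rV[R]_N
}.

Definition affine_apply (R : realType) (n N : nat) (A : affine_map R n N)
  (z : 'rV[R]_n) : 'rV[R]_N := z *m linear_part A + translation A.

Coercion affine_apply : affine_map >-> Funclass.

(* A family over E is a total function of (x, r); only its values at x in E and
   r > 0 are ever used. *)
Definition affine_family (R : realType) (n N : nat) :=
  'rV[R]_n -> R -> affine_map R n N.

Definition compatible (R : realType) (n N : nat) (eps : R) (E : set 'rV[R]_n)
    (A : affine_family R n N) : Prop :=
  forall (x y : 'rV[R]_n) (r s : R), E x -> E y -> 0 < r -> 0 < s ->
    enorm (x - y) <= Num.max r s -> 1 / 2 <= r / s <= 2 ->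
    opnorm (linear_part (A x r) - linear_part (A y s)) <=
      eps * Num.min (opnorm (linear_part (A x r))) (opnorm (linear_part (A y s))).

(* Only the values of f on E matter, so the domain X of f, E `<=` X, need not
   appear. *)
Definition almost_affine_with (R : realType) (n N : nat) (eps : R)
    (f : 'rV[R]_n -> 'rV[R]_N) (E : set 'rV[R]_n) (A : affine_family R n N) :
    Prop :=
  compatible eps E A /\
  forall (x : 'rV[R]_n) (r : R), E x -> 0 < r ->
    (ereal_sup [set (enorm (f z - A x r z))%:E | z in E `&` eclosed_ball x r] <=
       (eps * opnorm (linear_part (A x r)) * r)%:E)%E.

Definition almost_affine (R : realType) (n N : nat) (eps : R)
    (f : 'rV[R]_n -> 'rV[R]_N) (E : set 'rV[R]_n) : Prop :=
  exists A : affine_family R n N, almost_affine_with eps f E A.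

Definition topological_embedding (S T : topologicalType) (F : S -> T) : Prop :=
  continuous F /\
  exists g : T -> S, cancel F g /\ {within range F, continuous g}.

Definition weakly_quasisymmetric (R : realType) (n N : nat) (H : R)
    (F : 'rV[R]_n -> 'rV[R]_N) : Prop :=
  topological_embedding F /\
  forall a b x : 'rV[R]_n, enorm (a - x) <= enorm (b - x) ->
    enorm (F a - F x) <= H * enorm (F b - F x).

(* Main.v *)
Require Import Defs.
From HB Require Import structures.
From mathcomp Require Import all_boot all_order all_algebra.
From mathcomp Require Import polyrcf complex spectral.
From mathcomp Require Import all_classical all_reals all_analysis.
From mathcomp Require Import zify ring lra.

Set Implicit Arguments.
Unset Strict Implicit.
Unset Printing Implicit Defensive.

Import Order.TTheory GRing.Theory Num.Theory.
Import numFieldNormedType.Exports.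

Local Open Scope classical_set_scope.
Local Open Scope ring_scope.

(** Off [E] the extension is obtained by interpolating the given affine maps.
Let [d] be the distance to [E].  The index set consists of all vertices of the
cubic grids of mesh [expR k], [k] ranging over the integers; the vertex [v] of
mesh [s] carries the affine map [A e s], where [e] in [E] is almost nearest to
[v].  The weight of a vertex at [z] is a hat function of [ln (d z)], which
selects the two meshes comparable with [d z], times the multilinear weight of
the vertex in its grid.  These weights sum to 1 ([sum_weight]), at most
[4 * 4 ^ n] of them matter on the ball of radius [d x / 16] about [x]
([weight_window]), and there they are Lipschitz with constant a multiple of
[1 / d x] ([weight_lip]).

All constants come from one comparison principle.  If [(x, r)] and [(y, s)] are
comparable in scale and position, then [A x r] and [A y s] have linear parts
within [C eps] of each other, relatively ([compare_linear]), and differ by at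
most [C eps * opnorm * r] on a comparable ball ([compare_affine]).  Moreover,
moving from scale [r] up to an arbitrarily large scale [t] costs at most a
factor [t / r] ([close_scale]), which is just what is needed when a point [z]
much closer to [E] than [r] is compared with the map of scale [r]
([extension_above_base], [extension_large_scale]).  At scales below
[d x / 16] the interpolated map is, by the Lipschitz bound on the weights, an
affine map plus a perturbation with Lipschitz constant [C eps * opnorm]
([extension_lipschitz]).  Here [C] depends on [n] only.

The linear parts of the extended family are all taken from the original
family: at [(x, r)] one uses the map at an almost nearest point of [E] and at
scale [max r (d x)].  Hence the bound on the singular values is inherited with
the same constant [H], and the extended family agrees with [A] over [E].

Weak quasisymmetry follows from the map at [x] and scale [r = |b - x|]: by
[increment_le] and [increment_ge], [|F a - F x|] is at most
[(1 + 2 delta) * opnorm * r] and [H * |F b - F x|] at least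
[(1 - 2 delta H) * opnorm * r], so that the ratio is at most [rho H] as soon as
[delta] is small with respect to [H] and [rho].  That the quotient of extreme
singular values controls the distortion of lengths is the spectral theorem for
[L *m L^T], applied over the complex numbers ([symmetric_spectral]). *)

(** * Euclidean norm and operator norm *)

Section EuclideanNorm.
Variables (R : realType).

Lemma enorm_ge0 n (v : 'rV[R]_n) : 0 <= enorm v.
Proof. exact: sqrtr_ge0. Qed.

Lemma sqr_enorm n (v : 'rV[R]_n) : enorm v ^+ 2 = \sum_(i < n) v ord0 i ^+ 2.
Proof. by rewrite sqr_sqrtr// sumr_ge0// => i _; exact: sqr_ge0. Qed.

Lemma enorm0 n : enorm (0 : 'rV[R]_n) = 0.
Proof.
by rewrite /enorm big1 ?sqrtr0// => i _; rewrite mxE expr0n.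
Qed.

Lemma enormZ n (a : R) (v : 'rV[R]_n) : enorm (a *: v) = `|a| * enorm v.
Proof.
rewrite /enorm -sqrtr_sqr -sqrtrM ?sqr_ge0// mulr_sumr.
by congr Num.sqrt; apply: eq_bigr => i _; rewrite mxE exprMn.
Qed.

Lemma enormN n (v : 'rV[R]_n) : enorm (- v) = enorm v.
Proof. by rewrite -scaleN1r enormZ normrN normr1 mul1r. Qed.

Lemma enormBC n (u v : 'rV[R]_n) : enorm (u - v) = enorm (v - u).
Proof. by rewrite -enormN opprB. Qed.

Lemma coord_le_enorm n (v : 'rV[R]_n) i : `|v ord0 i| <= enorm v.
Proof.
rewrite -sqrtr_sqr ler_sqrt ?sumr_ge0//; last by move=> j _; exact: sqr_ge0.
by rewrite (bigD1 i)//= lerDl sumr_ge0// => j _; exact: sqr_ge0.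
Qed.

Lemma enorm_eq0 n (v : 'rV[R]_n) : enorm v = 0 -> v = 0.
Proof.
move=> v0; apply/rowP => i; rewrite mxE; apply: normr0_eq0; apply/eqP.
by rewrite eq_le normr_ge0 andbT -v0 coord_le_enorm.
Qed.

Lemma enorm_le_sum n (v : 'rV[R]_n) : enorm v <= \sum_(i < n) `|v ord0 i|.
Proof.
have s0 : 0 <= \sum_(i < n) `|v ord0 i| by exact: sumr_ge0.
rewrite -(ger0_norm s0) -sqrtr_sqr ler_sqrt ?sqr_ge0//.
rewrite [leRHS]expr2 mulr_suml; apply: ler_sum => i _.
rewrite -real_normK ?num_real// expr2 ler_wpM2l//.
by rewrite (bigD1 i)//= lerDl sumr_ge0.
Qed.

(** Expand the nonnegative sum of the squares of |v| u_i - |u| v_i. *)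
Lemma cauchy_schwarz n (u v : 'rV[R]_n) :
  \sum_(i < n) u ord0 i * v ord0 i <= enorm u * enorm v.
Proof.
have [u0|u0] := eqVneq (enorm u) 0.
  by rewrite (enorm_eq0 u0) enorm0 mul0r big1// => i _; rewrite mxE mul0r.
have [v0|v0] := eqVneq (enorm v) 0.
  by rewrite (enorm_eq0 v0) enorm0 mulr0 big1// => i _; rewrite mxE mulr0.
have up : 0 < enorm u by rewrite lt_neqAle eq_sym u0 enorm_ge0.
have vp : 0 < enorm v by rewrite lt_neqAle eq_sym v0 enorm_ge0.
have : 0 <= \sum_(i < n) (enorm v * u ord0 i - enorm u * v ord0 i) ^+ 2.
  by apply: sumr_ge0 => i _; exact: sqr_ge0.
have -> : \sum_(i < n) (enorm v * u ord0 i - enorm u * v ord0 i) ^+ 2 =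
    enorm v ^+ 2 * \sum_(i < n) u ord0 i ^+ 2
    - (enorm u * enorm v * \sum_(i < n) u ord0 i * v ord0 i) *+ 2
    + enorm u ^+ 2 * \sum_(i < n) v ord0 i ^+ 2.
  rewrite !mulr_sumr -sumrMnl -sumrB -big_split /=.
  by apply: eq_bigr => i _; ring.
rewrite -!sqr_enorm.
have -> : enorm v ^+ 2 * enorm u ^+ 2
  - enorm u * enorm v * (\sum_(i < n) u ord0 i * v ord0 i) *+ 2
  + enorm u ^+ 2 * enorm v ^+ 2 = (enorm u * enorm v) *
  ((enorm u * enorm v - \sum_(i < n) u ord0 i * v ord0 i) *+ 2) by ring.
by rewrite pmulr_rge0 ?mulr_gt0// pmulrn_lge0// subr_ge0.
Qed.

Lemma enormD n (u v : 'rV[R]_n) : enorm (u + v) <= enorm u + enorm v.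
Proof.
have s0 : 0 <= enorm u + enorm v by rewrite addr_ge0 ?enorm_ge0.
rewrite -(ger0_norm s0) -sqrtr_sqr ler_sqrt ?sqr_ge0//.
have -> : \sum_(i < n) (u + v) ord0 i ^+ 2 = \sum_(i < n) u ord0 i ^+ 2 +
   (\sum_(i < n) u ord0 i * v ord0 i) *+ 2 + \sum_(i < n) v ord0 i ^+ 2.
  rewrite -sumrMnl -!big_split /=.
  by apply: eq_bigr => i _; rewrite mxE; ring.
rewrite -!sqr_enorm sqrrD lerD2r lerD2l ler_pMn2r//; exact: cauchy_schwarz.
Qed.

Lemma enormB n (u v : 'rV[R]_n) : enorm (u - v) <= enorm u + enorm v.
Proof. by rewrite -(enormN v) enormD. Qed.

Lemma enorm_dist n (u v w : 'rV[R]_n) :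
  enorm (u - w) <= enorm (u - v) + enorm (v - w).
Proof. by rewrite -[u - w](subrKA v) enormD. Qed.

Lemma enorm_sum n (I : Type) (s : seq I) (P : pred I) (h : I -> 'rV[R]_n) :
  enorm (\sum_(i <- s | P i) h i) <= \sum_(i <- s | P i) enorm (h i).
Proof.
elim/big_ind2: _ => [|u a v b ua vb|//]; first by rewrite enorm0.
by apply: le_trans (enormD _ _) _; exact: lerD.
Qed.

Section OperatorNorm.
Variables (n N : nat).
Implicit Types L M : 'M[R]_(n, N).

Lemma enorm_mulmx_bounded L :
  exists C, forall v : 'rV[R]_n, enorm (v *m L) <= C * enorm v.
Proof.
exists (\sum_(j < N) \sum_(i < n) `|L i j|) => v.
apply: le_trans (enorm_le_sum _) _.
rewrite mulr_suml; apply: ler_sum => j _; rewrite mxE mulr_suml.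
apply: le_trans (ler_norm_sum _ _ _) _; apply: ler_sum => i _.
by rewrite normrM mulrC ler_wpM2l// coord_le_enorm.
Qed.

Lemma opnorm_has_ub L :
  has_ubound [set enorm (v *m L) | v in [set v : 'rV[R]_n | enorm v <= 1]].
Proof.
have [C CL] := enorm_mulmx_bounded L.
exists `|C| => _ [v /= v1 <-]; apply: le_trans (CL v) _.
apply: le_trans (ler_norm _) _; rewrite normrM (ger0_norm (enorm_ge0 v)).
by rewrite ler_piMr.
Qed.

Lemma enorm_mulmx L (v : 'rV[R]_n) : enorm (v *m L) <= opnorm L * enorm v.
Proof.
have [v0|v0] := eqVneq (enorm v) 0.
  by rewrite (enorm_eq0 v0) mul0mx !enorm0 mulr0.
have vp : 0 < enorm v by rewrite lt_neqAle eq_sym v0 enorm_ge0.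
rewrite -ler_pdivrMr//.
have -> : enorm (v *m L) / enorm v = enorm (((enorm v)^-1 *: v) *m L).
  by rewrite -scalemxAl enormZ gtr0_norm ?invr_gt0// mulrC.
apply: (ub_le_sup (opnorm_has_ub L)); exists ((enorm v)^-1 *: v) => //=.
by rewrite enormZ gtr0_norm ?invr_gt0// mulVf.
Qed.

Lemma opnorm_le L c : (forall v : 'rV[R]_n, enorm (v *m L) <= c * enorm v) ->
  0 <= c -> opnorm L <= c.
Proof.
move=> Lc c0; apply: ge_sup; first by exists (enorm (0 *m L)), 0 => //=; rewrite enorm0.
by move=> _ [v /= v1 <-]; apply: le_trans (Lc v) _; rewrite ler_piMr.
Qed.

Lemma opnorm_ge0 L : 0 <= opnorm L.
Proof.
apply: le_trans (enorm_ge0 (0 *m L)) _.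
by apply: (ub_le_sup (opnorm_has_ub L)); exists 0 => //=; rewrite enorm0.
Qed.

Lemma opnormD L M : opnorm (L + M) <= opnorm L + opnorm M.
Proof.
apply: opnorm_le => [v|]; last by rewrite addr_ge0 ?opnorm_ge0.
rewrite mulmxDr mulrDl; apply: le_trans (enormD _ _) _.
by rewrite lerD ?enorm_mulmx.
Qed.

Lemma opnormN L : opnorm (- L) = opnorm L.
Proof.
suff opN M : opnorm (- M) <= opnorm M.
  by apply/eqP; rewrite eq_le opN -{1}[L]opprK opN.
apply: opnorm_le => [v|]; last exact: opnorm_ge0.
by rewrite mulmxN enormN enorm_mulmx.
Qed.

Lemma opnormBC L M : opnorm (L - M) = opnorm (M - L).
Proof. by rewrite -opnormN opprB. Qed.

End OperatorNorm.
End EuclideanNorm.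

(** * Singular values *)

Section SingularValues.
Variables (R : realType).

Lemma char_poly_similar (F : fieldType) n (P D : 'M[F]_n) : P \in unitmx ->
  char_poly (invmx P *m D *m P) = char_poly D.
Proof.
move=> Pu; pose C := @map_mx F {poly F} polyC n n.
have CPV : C (invmx P) *m C P = 1%:M by rewrite /C -map_mxM mulVmx// map_mx1.
have -> : char_poly (invmx P *m D *m P) =
    \det (C (invmx P) *m char_poly_mx D *m C P).
  congr (\det _); rewrite /char_poly_mx mulmxBr mulmxBl !map_mxM /=.
  by rewrite scalar_mxC -[X in _ = X - _]mulmxA CPV mulmx1.
rewrite !det_mulmx [X in X * _ = _]mulrC -mulrA -det_mulmx.
by rewrite CPV det1 mulr1.
Qed.

(** The eigenbasis lives over the complex numbers, where the matrix is normal
with real spectrum; [c i] is the squared modulus of the [i]-th coordinate of [v]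
in it.  Only the real numbers [e i] and [c i] survive in the statement. *)
Lemma symmetric_spectral n (M : 'M[R]_n) : M^T = M ->
  exists e : 'I_n -> R,
    char_poly M = \prod_(i < n) ('X - (e i)%:P) /\
    forall v : 'rV[R]_n, exists c : 'I_n -> R,
      [/\ forall i, 0 <= c i, (v *m v^T) 0 0 = \sum_i c i &
          (v *m M *m v^T) 0 0 = \sum_i e i * c i].
Proof.
move=> Msym.
pose toC := real_complex R.
pose MC := map_mx toC M.
have realC (x : R) : toC x \is Num.real.
  by apply/complex_realP; exists x.
have MCherm : MC \is hermsymmx.
  apply: realsym_hermsym.
    by apply/is_hermitianmxP; rewrite expr0 scale1r map_mx_id// /MC map_trmx Msym.
  by apply/mxOverP => i j; rewrite mxE.
have MCnorm := hermitian_normalmx MCherm.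
have dreal := hermitian_spectral_diag_real MCherm.
have /orthomx_spectralP := MCnorm.
set P := spectralmx MC; set d := spectral_diag MC => MCE.
have PU : P \is unitarymx := spectral_unitarymx _.
pose e i := complex.Re (d 0 i).
have de i : d 0 i = toC (e i).
  by have /mxOverP/(_ 0 i)/RRe_real := dreal.
exists e; split.
  apply: (map_poly_inj (real_complex R)).
  rewrite map_char_poly /= -/MC MCE char_poly_similar ?unitarymx_unit//.
  rewrite char_poly_trig ?diag_mx_is_trig// rmorph_prod/=.
  apply: eq_bigr => i _.
  by rewrite rmorphB/= map_polyX map_polyC/= mxE eqxx mulr1n de.
move=> v; pose vC := map_mx toC v; pose w := vC *m P^t*%sesqui.
have vCt : P *m vC^T = w^t*%sesqui.
  rewrite /w trmx_mul map_mxM /= trmxCK; congr (_ *m _).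
  by apply/matrixP => i j; rewrite !mxE; exact/esym/conjc_real.
exists (fun i => Normc.normc (w 0 i) ^+ 2); split => [i||].
- exact: sqr_ge0.
- apply: (@complexI R).
  have -> : real_complex R ((v *m v^T) 0 0) = (vC *m vC^T) 0 0.
    by rewrite /vC map_trmx -map_mxM [RHS]mxE.
  rewrite -[vC^T](mulKmx (unitarymx_unit PU)) vCt invmx_unitary// mulmxA -/w.
  rewrite mxE rmorph_sum; apply: eq_bigr => i _.
  by rewrite !mxE -sqr_normc /= -rmorphXn.
- apply: (@complexI R).
  have -> : real_complex R ((v *m M *m v^T) 0 0) = (vC *m MC *m vC^T) 0 0.
    by rewrite /vC /MC map_trmx -!map_mxM [RHS]mxE.
  rewrite MCE invmx_unitary// !mulmxA -/w -mulmxA vCt.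
  rewrite mxE rmorph_sum; apply: eq_bigr => i _.
  by rewrite mul_mx_diag !mxE mulrAC -sqr_normc /= de rmorphM mulrC -rmorphXn.
Qed.

Lemma sorted_flatten_nseq (r : seq R) (m : R -> nat) : sorted <%R r ->
  sorted <=%R (flatten [seq nseq (m x) x | x <- r]).
Proof.
rewrite (sorted_pairwise lt_trans) => rs; rewrite (sorted_pairwise le_trans).
elim: r rs => [//|x r IHr] /= /andP[xr rs].
rewrite pairwise_cat IHr// andbT; apply/andP; split; last first.
  by elim: (m x) => //= k ->; rewrite andbT all_nseq lexx orbT.
apply/allrelP => y z /nseqP[-> _] /flattenP[_ /mapP[t tr ->]] /nseqP[-> _].
by apply: ltW; move/allP: xr => /(_ _ tr).
Qed.

(** The list in the definition of the singular values loses nothing when the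
polynomial splits: it is then the multiset of all the roots. *)
Lemma perm_flatten_nseq_mup (s : seq R) :
  let p := \prod_(y <- s) ('X - y%:P) in
  perm_eq (flatten [seq nseq (mup x p) x | x <- rootsR p]) s.
Proof.
rewrite /=; set p := \prod_(y <- s) _; apply/allP => x _ /=; apply/eqP.
have p0 : p != 0 by rewrite monic_neq0// monic_prod_XsubC.
rewrite count_flatten -map_comp sumnE big_map.
rewrite (eq_bigr (fun y => if y == x then mup y p else 0%N)); last first.
  by move=> y _ /=; rewrite count_nseq /=; case: eqP => _; rewrite ?mul1n ?mul0n.
rewrite -mu_prod_XsubC -/p; have [xr|xr] := boolP (x \in rootsR p).
  have ru : uniq (rootsR p) := sorted_uniq lt_trans ltxx (sorted_roots _ _ _).
  by rewrite (bigD1_seq x)//= eqxx big1 ?addn0// => y /negPf->.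
rewrite big1_seq; last by move=> y /andP[_ yr]; case: eqP => // yx; rewrite -yx yr in xr.
apply/esym/mupNroot; apply: contra xr => xr.
by have := roots_on_rootsR p0 x; rewrite xr andbT => <-.
Qed.

(** As the characteristic polynomial of [L *m L^T] splits, the sorted list of its
roots has length exactly [n], so that its first and last entries are the extreme
eigenvalues; they bound the Rayleigh quotient of every [v].  Square roots of
negative numbers being 0, the signs of the eigenvalues need not be known. *)
Lemma singval_bounds n N (L : 'M[R]_(n, N)) (v : 'rV[R]_n) : (0 < n)%N ->
  singval 1 L * enorm v <= enorm (v *m L) <= singval n L * enorm v.
Proof.
move=> n0; pose M := L *m L^T.
have Msym : M^T = M by rewrite /M trmx_mul trmxK.
have [e [pE quad]] := symmetric_spectral Msym.
have [c [c0 vE MvE]] := quad v.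
have enE k (u : 'rV[R]_k) : enorm u ^+ 2 = (u *m u^T) 0 0.
  by rewrite sqr_enorm mxE; apply: eq_bigr => i _; rewrite !mxE expr2.
pose s := [seq e i | i <- enum 'I_n].
pose s' := flatten [seq nseq (mup x (char_poly M)) x | x <- rootsR (char_poly M)].
have pE' : char_poly M = \prod_(y <- s) ('X - y%:P).
  by rewrite pE big_map big_enum.
have ps : perm_eq s' s by rewrite /s' pE'; exact: perm_flatten_nseq_mup.
have s's : sorted <=%R s' by apply: sorted_flatten_nseq; exact: sorted_roots.
have szs' : size s' = n by rewrite (perm_size ps) size_map size_enum_ord.
have svE k : (0 < k <= n)%N -> singval k L = Num.sqrt (nth 0 s' k.-1).
  move=> /andP[k0 kn].
  rewrite -(nth_map 0 0) ?szs' ?prednK// /singval /singular_values.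
  congr (nth _ _ _); rewrite map_flatten -map_comp; congr flatten.
  by apply: eq_map => x /=; rewrite map_nseq.
have es' i : exists2 k, (k < n)%N & e i = nth 0 s' k.
  have : e i \in s' by rewrite (perm_mem ps) map_f// mem_enum.
  by move=> /(nthP 0)[k]; rewrite szs' => kn <-; exists k.
have lo i : nth 0 s' 0 <= e i.
  have [k kn ->] := es' i; apply: (sorted_leq_nth le_trans lexx) => //;
    by rewrite inE szs'.
have hi i : e i <= nth 0 s' n.-1.
  have [k kn ->] := es' i; apply: (sorted_leq_nth le_trans lexx) => //;
    by rewrite ?inE ?szs' ?prednK// -ltnS prednK.
have vL : enorm (v *m L) ^+ 2 = \sum_i e i * c i.
  by rewrite enE -MvE /M trmx_mul !mulmxA.
have sq_le (a b : R) : 0 <= a -> 0 <= b -> a ^+ 2 <= b ^+ 2 -> a <= b.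
  by move=> a0 b0; rewrite ler_sqr ?nnegrE.
rewrite !svE ?n0 ?leqnn//=; apply/andP; split; apply: sq_le;
  rewrite ?mulr_ge0 ?sqrtr_ge0 ?enorm_ge0// exprMn vL enE vE.
- have [m0|m0] := leP 0 (nth 0 s' 0).
    by rewrite sqr_sqrtr// mulr_sumr ler_sum// => i _; rewrite ler_wpM2r.
  rewrite ler0_sqrtr ?(ltW m0)// expr0n mul0r -vL; exact: sqr_ge0.
- rewrite mulr_sumr ler_sum// => i _; rewrite ler_wpM2r//.
  apply: le_trans (hi i) _; have [m0|m0] := leP 0 (nth 0 s' n.-1).
    by rewrite sqr_sqrtr.
  by apply: le_trans (ltW m0) _; exact: sqr_ge0.
Qed.

Lemma singval_ge0 n N (L : 'M[R]_(n, N)) k : 0 <= singval k L.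
Proof.
rewrite /singval; set s := singular_values L.
have [ks|ks] := ltnP k.-1 (size s); last by rewrite nth_default.
have /flattenP[_ /mapP[x _ ->] /nseqP[-> _]] := mem_nth 0 ks.
exact: sqrtr_ge0.
Qed.

(** The form in which the hypothesis on the singular values is used: no vector is
shrunk by more than a factor [H] with respect to the operator norm. *)
Lemma opnorm_le_enorm_mulmx n N (L : 'M[R]_(n, N)) (H : R) (v : 'rV[R]_n) :
  (0 < n)%N -> 0 <= H -> singval n L <= H * singval 1 L ->
  opnorm L * enorm v <= H * enorm (v *m L).
Proof.
move=> n0 H0 LH.
have Ln : opnorm L <= singval n L.
  apply: opnorm_le => [u|]; last exact: singval_ge0.
  by have /andP[] := singval_bounds L u n0.
apply: (@le_trans _ _ (H * singval 1 L * enorm v)).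
  by rewrite ler_wpM2r ?enorm_ge0// (le_trans Ln).
by rewrite -mulrA ler_wpM2l//; have /andP[] := singval_bounds L v n0.
Qed.

End SingularValues.

(** * Comparison of the members of a compatible family *)

Section AlmostAffineFamilies.
Variables (R : realType) (n N : nat).
Variable eps : R.
Hypotheses (eps_ge0 : 0 <= eps) (eps_le1 : eps <= 1).
Implicit Types (L M P : 'M[R]_(n, N)) (a b c : R).

(** Relative closeness with parameter [c - 1] rather than [c], so that parameters
multiply along a chain of comparisons ([close_trans]) and [c] also bounds the
ratio of the norms ([close_opnorm]). *)
Definition close c L M :=
  opnorm (L - M) <= (c - 1) * eps * Num.min (opnorm L) (opnorm M).

Lemma close_sym c L M : close c L M -> close c M L.
Proof. by rewrite /close opnormBC minC. Qed.

Lemma close_dist c L M : 1 <= c -> close c L M ->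
  opnorm (L - M) <= (c - 1) * eps * opnorm L.
Proof.
move=> c1 /le_trans; apply; rewrite ler_wpM2l ?ge_min ?lexx//.
by rewrite mulr_ge0// subr_ge0.
Qed.

Lemma closeP c L M : opnorm (L - M) <= (c - 1) * eps * opnorm L ->
  opnorm (L - M) <= (c - 1) * eps * opnorm M -> close c L M.
Proof. by rewrite /close => LM1 LM2; case: (leP (opnorm L) (opnorm M)). Qed.

Lemma close_weak c c' L M : c <= c' -> close c L M -> close c' L M.
Proof.
move=> cc' /le_trans; apply; rewrite ler_wpM2r ?le_min ?opnorm_ge0//.
by rewrite ler_wpM2r// lerD2r.
Qed.

Lemma close_opnorm c L M : 1 <= c -> close c L M -> opnorm M <= c * opnorm L.
Proof.
move=> c1 LM; rewrite -[M](subrK L); apply: le_trans (opnormD _ _) _.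
rewrite opnormBC; have := close_dist c1 LM.
have : (c - 1) * eps * opnorm L <= (c - 1) * opnorm L.
  by rewrite ler_wpM2r ?opnorm_ge0// ler_piMr// subr_ge0.
lra.
Qed.

Lemma close_trans a b L M P : 1 <= a -> 1 <= b ->
  close a L M -> close b M P -> close (a * b) L P.
Proof.
move=> a1 b1 LM MP.
have ML := close_sym LM; have PM := close_sym MP.
have tri : opnorm (L - P) <= opnorm (L - M) + opnorm (M - P).
  by rewrite -[L - P](subrKA M) opnormD.
have ae : 0 <= (a - 1) * eps by rewrite mulr_ge0// subr_ge0.
have be : 0 <= (b - 1) * eps by rewrite mulr_ge0// subr_ge0.
apply: closeP; apply: le_trans tri _.
- have h1 := close_dist a1 LM; have h2 := close_dist b1 MP.
  have h3 := ler_wpM2l be (close_opnorm a1 LM).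
  have -> : (a * b - 1) * eps * opnorm L =
    (a - 1) * eps * opnorm L + (b - 1) * eps * (a * opnorm L) by ring.
  lra.
- rewrite [opnorm (L - M)]opnormBC [opnorm (M - P)]opnormBC.
  have h1 := close_dist a1 ML; have h2 := close_dist b1 PM.
  have h3 := ler_wpM2l ae (close_opnorm b1 PM).
  have -> : (a * b - 1) * eps * opnorm P =
    (b - 1) * eps * opnorm P + (a - 1) * eps * (b * opnorm P) by ring.
  lra.
Qed.

Lemma affine_applyB (B : affine_map R n N) (y z : 'rV[R]_n) :
  B z - B y = (z - y) *m linear_part B.
Proof. by rewrite /affine_apply opprD addrACA subrr addr0 mulmxBl. Qed.

Variables (E : set 'rV[R]_n) (f : 'rV[R]_n -> 'rV[R]_N).
Variable (A : affine_family R n N).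
Hypothesis AA : almost_affine_with eps f E A.

Local Notation L x r := (linear_part (A x r)).
Local Notation D x r := (opnorm (linear_part (A x r))).

Lemma almost_affineP x z r : E x -> 0 < r -> E z -> enorm (z - x) <= r ->
  enorm (f z - A x r z) <= eps * D x r * r.
Proof.
move=> Ex r0 Ez zx; rewrite -lee_fin; apply: le_trans (AA.2 x r Ex r0).
by apply: ereal_sup_ubound; exists z.
Qed.

(** Double the scale until [t] is reached: each step multiplies the parameter by
2, as it does the scale, hence the linear dependence on [t / r].  The extra
factor 2 pays for the last, incomplete step. *)
Lemma close_scale x r t : E x -> 0 < r -> r <= t ->
  close (2 * t / r) (L x r) (L x t).
Proof.
move=> Ex r0 rt.
have [k tk] : exists k : nat, t <= 2 ^+ k * r.
  exists (Num.trunc (t / r)).+1; rewrite -ler_pdivrMr//.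
  apply: (@le_trans _ _ (Num.trunc (t / r)).+1%:R).
    by apply: ltW; exact: truncnS_gt.
  by rewrite -natrX ler_nat ltnW// ltn_expl.
elim: k r r0 rt tk => [|k IHk] r r0 rt tk.
  have -> : t = r by apply/eqP; rewrite eq_le rt; rewrite expr0 mul1r in tk; rewrite tk.
  rewrite /close subrr.
  apply: (@le_trans _ _ 0).
    by apply: opnorm_le => // v; rewrite mulmx0 enorm0 mul0r.
  rewrite mulr_ge0 ?le_min ?opnorm_ge0// mulr_ge0//.
  by rewrite mulfK ?gt_eqF//; lra.
have tgt0 : 0 < t by exact: lt_le_trans rt.
have [t2r|t2r] := leP t (2 * r).
  apply: (@close_weak 2); first by rewrite ler_pdivlMr// ler_wpM2l.
  rewrite /close; have -> : (2 - 1 : R) * eps = eps by ring.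
  apply: AA.1 => //.
    by rewrite subrr enorm0 le_max ltW.
  rewrite ler_pdivlMr// ler_pdivrMr//; apply/andP; split; lra.
have -> : 2 * t / r = 2 * (2 * t / (2 * r)) by field; rewrite gt_eqF.
apply: (@close_trans 2 _ _ (L x (2 * r))) => //; first by lra.
- by rewrite ler_pdivlMr; lra.
- rewrite /close; have -> : (2 - 1 : R) * eps = eps by ring.
  apply: AA.1 => //; first lra.
    by rewrite subrr enorm0 le_max ltW.
  by rewrite ler_pdivlMr ?ler_pdivrMr; try lra; apply/andP; split; lra.
- by apply: IHk; [lra|exact: ltW|rewrite mulrA -exprSr].
Qed.

Lemma close_points x y t : E x -> E y -> 0 < t -> enorm (x - y) <= t ->
  close 2 (L x t) (L y t).
Proof.
move=> Ex Ey t0 xy; rewrite /close; have -> : (2 - 1 : R) * eps = eps by ring.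
apply: AA.1 => //; first by rewrite maxxx.
by rewrite divff ?gt_eqF//; apply/andP; split; lra.
Qed.

(** Both maps are close to [f] at [x], and the drift of the linear parts, of order
[t / r], acts on a vector of length [K * r] only: the powers of [r] cancel, and
the bound does not depend on the ratio of the scales. *)
Lemma affine_vertical K x z r t : E x -> 0 < r -> r <= t ->
  enorm (z - x) <= K * r ->
  enorm (A x r z - A x t z) <= (3 + 2 * K) * eps * D x t * t.
Proof.
move=> Ex r0 rt zx.
have t0 : 0 < t by exact: lt_le_trans rt.
have tr1 : 1 <= 2 * t / r by rewrite ler_pdivlMr//; lra.
have c := close_scale Ex r0 rt.
have xx s : 0 < s -> enorm (x - x) <= s by rewrite subrr enorm0 => /ltW.
have h1 := almost_affineP Ex r0 Ex (xx _ r0).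
have h2 := almost_affineP Ex t0 Ex (xx _ t0).
have h3 := close_opnorm tr1 (close_sym c).
have h4 := close_dist tr1 (close_sym c); rewrite opnormBC in h4.
have -> : A x r z - A x t z = (f x - A x t x) - (f x - A x r x)
    + (z - x) *m (L x r - L x t).
  rewrite mulmxBr -!affine_applyB.
  by apply/rowP => i; rewrite !mxE; ring.
apply: le_trans (enormD _ _) _.
have h5 := enormB (f x - A x t x) (f x - A x r x).
have h6 : enorm ((z - x) *m (L x r - L x t)) <= 2 * K * eps * D x t * t.
  apply: le_trans (enorm_mulmx _ _) _.
  apply: le_trans (ler_pM (opnorm_ge0 _) (enorm_ge0 _) h4 zx) _.
  have -> : (2 * t / r - 1) * eps * D x t * (K * r) =
     2 * K * eps * D x t * t - K * r * (eps * D x t) by field; rewrite gt_eqF.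
  rewrite gerBl mulr_ge0//; last by rewrite mulr_ge0// opnorm_ge0.
  exact: le_trans (enorm_ge0 _) zx.
have h7 : eps * D x r * r <= 2 * eps * D x t * t.
  have -> : 2 * eps * D x t * t = eps * (2 * t / r * D x t) * r.
    by field; rewrite gt_eqF.
  by rewrite ler_wpM2r ?(ltW r0)// ler_wpM2l.
have -> : (3 + 2 * K) * eps * D x t * t =
  eps * D x t * t + 2 * eps * D x t * t + 2 * K * eps * D x t * t by ring.
lra.
Qed.

(** Both maps approximate [f] at [y]. *)
Lemma affine_horizontal K x y z t : E x -> E y -> 0 < t ->
  enorm (x - y) <= t -> enorm (z - y) <= K * t ->
  enorm (A x t z - A y t z) <= (3 + K) * eps * D x t * t.
Proof.
move=> Ex Ey t0 xy zy.
have c := close_points Ex Ey t0 xy.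
have c12 : (1 : R) <= 2 by lra.
have yy : enorm (y - y) <= t by rewrite subrr enorm0 ltW.
have h1 := almost_affineP Ex t0 Ey; rewrite enormBC in h1; have {}h1 := h1 xy.
have h2 := almost_affineP Ey t0 Ey yy.
have h3 := close_opnorm c12 c.
have h4 := close_dist c12 c.
have -> : A x t z - A y t z = (f y - A y t y) - (f y - A x t y)
    + (z - y) *m (L x t - L y t).
  rewrite mulmxBr -!affine_applyB.
  by apply/rowP => i; rewrite !mxE; ring.
apply: le_trans (enormD _ _) _.
have h5 := enormB (f y - A y t y) (f y - A x t y).
have h6 : enorm ((z - y) *m (L x t - L y t)) <= K * eps * D x t * t.
  apply: le_trans (enorm_mulmx _ _) _.
  apply: le_trans (ler_pM (opnorm_ge0 _) (enorm_ge0 _) h4 zy) _.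
  by rewrite le_eqVlt; apply/orP; left; apply/eqP; ring.
have h7 : eps * D y t * t <= 2 * eps * D x t * t.
  have -> : 2 * eps * D x t * t = eps * (2 * D x t) * t by ring.
  by rewrite ler_wpM2r ?(ltW t0)// ler_wpM2l.
have -> : (3 + K) * eps * D x t * t =
  eps * D x t * t + 2 * eps * D x t * t + K * eps * D x t * t by ring.
lra.
Qed.

(** Go up from [r] to the scale [K * r], across from [x] to [y], and down to [s]. *)
Lemma compare_linear (K : R) x y r s :
  1 <= K -> E x -> E y -> 0 < r -> 0 < s -> r <= K * s -> s <= K * r ->
  enorm (x - y) <= K * r ->
  close (8 * K ^+ 3) (L x r) (L y s).
Proof.
move=> K1 Ex Ey r0 s0 rs sr xy.
have t0 : 0 < K * r by rewrite mulr_gt0//; lra.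
have rt : r <= K * r by rewrite ler_peMl// ltW.
have c1 := close_scale Ex r0 rt.
have c2 := close_points Ex Ey t0 xy.
have c3 := close_sym (close_scale Ey s0 sr).
have a1 : 1 <= 2 * (K * r) / r by rewrite ler_pdivlMr//; lra.
have a3 : 1 <= 2 * (K * r) / s by rewrite ler_pdivlMr//; lra.
have a2 : 1 <= 2 * (2 * (K * r) / s) by lra.
have := close_trans a1 a2 c1 (close_trans _ a3 c2 c3).
have -> : (1 : R) <= 2 by lra.
move=> /(_ isT); apply: close_weak.
have -> : 2 * (K * r) / r * (2 * (2 * (K * r) / s)) = 8 * K ^+ 2 * r / s.
  by field; rewrite !gt_eqF.
rewrite ler_pdivrMr//.
have -> : 8 * K ^+ 3 * s = 8 * K ^+ 2 * (K * s) by ring.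
by rewrite ler_wpM2l// mulr_ge0// sqr_ge0.
Qed.

(** In [compare_affine] the steps up, across and down cost [3 + 2 * k], [5] and
[6 + 8 * k ^+ 2], measured at scale [k * r]; the factor [2 * k ^+ 2] brings both
the norm and the scale back to [r]. *)
Definition affine_cst (k : R) : R := (14 + 2 * k + 8 * k ^+ 2) * 2 * k ^+ 2.

Lemma compare_affine (K : R) x y r s z :
  1 <= K -> E x -> E y -> 0 < r -> 0 < s -> r <= K * s -> s <= K * r ->
  enorm (x - y) <= K * r ->
  enorm (z - x) <= K * r ->
  enorm (A x r z - A y s z) <= affine_cst K * eps * D x r * r.
Proof.
move=> K1 Ex Ey r0 s0 rs sr xy zx.
have t0 : 0 < K * r by rewrite mulr_gt0//; lra.
have rt : r <= K * r by rewrite ler_peMl// ltW.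
have c1 := close_scale Ex r0 rt.
have c2 := close_points Ex Ey t0 xy.
have a1 : 1 <= 2 * (K * r) / r by rewrite ler_pdivlMr//; lra.
have h1 := close_opnorm a1 c1.
have h2 : D y (K * r) <= 2 * D x (K * r) by apply: close_opnorm c2; lra.
have zy : enorm (z - y) <= 2 * (K * r).
  by have := enorm_dist z x y; lra.
have zy' : enorm (z - y) <= 2 * K ^+ 2 * s.
  apply: le_trans zy _; rewrite -mulrA ler_wpM2l// expr2 -mulrA.
  by rewrite ler_wpM2l//; lra.
have v1 := affine_vertical Ex r0 rt zx.
have v2 := affine_horizontal Ex Ey t0 xy zy.
have v3 := affine_vertical Ey s0 sr zy'; rewrite enormBC in v3.
have := enorm_dist (A x r z) (A x (K * r) z) (A y s z).
have := enorm_dist (A x (K * r) z) (A y (K * r) z) (A y s z).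
have h3 : (3 + 2 * (2 * K ^+ 2)) * eps * D y (K * r) * (K * r) <=
    (6 + 8 * K ^+ 2) * eps * D x (K * r) * (K * r).
  rewrite ler_wpM2r ?(ltW t0)//.
  have -> : (6 + 8 * K ^+ 2) * eps * D x (K * r) =
    (3 + 2 * (2 * K ^+ 2)) * eps * (2 * D x (K * r)) by ring.
  by rewrite ler_wpM2l// mulr_ge0//; have := sqr_ge0 K; lra.
have h4 : (14 + 2 * K + 8 * K ^+ 2) * eps * (K * r) * D x (K * r) <=
    affine_cst K * eps * D x r * r.
  have -> : affine_cst K * eps * D x r * r =
    (14 + 2 * K + 8 * K ^+ 2) * eps * (K * r) * (2 * (K * r) / r * D x r).
    by rewrite /affine_cst; field; rewrite gt_eqF.
  rewrite ler_wpM2l// mulr_ge0 ?(ltW t0)// mulr_ge0//.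
  by have := sqr_ge0 K; lra.
have e : (14 + 2 * K + 8 * K ^+ 2) * eps * (K * r) * D x (K * r) =
  (3 + 2 * K) * eps * D x (K * r) * (K * r) + (3 + 2) * eps * D x (K * r) * (K * r)
  + (6 + 8 * K ^+ 2) * eps * D x (K * r) * (K * r) by ring.
lra.
Qed.

(** If one linear part vanished, compatibility would make the linear parts at all
larger scales vanish, and the approximation would be exact: [f] would be
constant. *)
Lemma opnorm_gt0 x r : (exists y z, E y /\ E z /\ f y <> f z) ->
  E x -> 0 < r -> 0 < D x r.
Proof.
move=> [y [z [Ey [Ez fyz]]]] Ex r0; rewrite lt_neqAle opnorm_ge0 andbT.
apply/eqP => D0; apply: fyz.
suff fE w : E w -> f w = A x r x by rewrite (fE y)// (fE z).
move=> Ew; pose t := r + enorm (w - x).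
have t0 : 0 < t by rewrite ltr_wpDr// enorm_ge0.
have rt : r <= t by rewrite lerDl enorm_ge0.
have Dt : D x t = 0.
  apply/eqP; rewrite eq_le opnorm_ge0 andbT.
  have := close_opnorm _ (close_scale Ex r0 rt); rewrite -D0 mulr0; apply.
  by rewrite ler_pdivlMr//; lra.
have fA u s : E u -> 0 < s -> D x s = 0 -> enorm (u - x) <= s -> f u = A x s u.
  move=> Eu s0 Ds us; apply/eqP; rewrite -subr_eq0; apply/eqP/enorm_eq0/eqP.
  by rewrite eq_le enorm_ge0 andbT (le_trans (almost_affineP Ex s0 Eu us))// Ds mulr0 mul0r.
have xx s : 0 < s -> enorm (x - x) <= s by rewrite subrr enorm0 => /ltW.
have fw : f w = A x t w by apply: fA => //; rewrite lerDr ltW.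
have fx := fA _ _ Ex t0 Dt (xx _ t0).
have fx' := fA _ _ Ex r0 (esym D0) (xx _ r0).
rewrite fw -fx' fx; apply/eqP; rewrite -subr_eq0 affine_applyB.
apply/eqP/enorm_eq0/eqP; rewrite eq_le enorm_ge0 andbT.
by apply: le_trans (enorm_mulmx _ _) _; rewrite Dt mul0r.
Qed.

End AlmostAffineFamilies.

(** * Euclidean balls and distance to a closed set *)

Section EuclideanTopology.
Variables (R : realType) (n : nat).

Lemma ball_enorm (x y : 'rV[R]_n) e : 0 < e -> enorm (x - y) < e -> ball x e y.
Proof.
move=> e0 xy; rewrite /ball /=; split=> // i j; rewrite (ord1 i).
apply: le_lt_trans xy; have := coord_le_enorm (x - y) j; by rewrite !mxE.
Qed.

Lemma enorm_ball (x y : 'rV[R]_n) e : ball x e y -> enorm (x - y) <= n%:R * e.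
Proof.
move=> [_ xy]; apply: le_trans (enorm_le_sum _) _.
have -> : n%:R * e = \sum_(j < n) e by rewrite sumr_const card_ord mulr_natl.
by apply: ler_sum => j _; apply: ltW; have := xy ord0 j; rewrite !mxE.
Qed.

End EuclideanTopology.

Section DistanceToSet.
Variables (R : realType) (n : nat) (E : set 'rV[R]_n).
Hypothesis E0 : E !=set0.

Definition edist (x : 'rV[R]_n) : R := inf [set enorm (x - e) | e in E].

Lemma edist_has_lbound x : has_lbound [set enorm (x - e) | e in E].
Proof. by exists 0 => _ [e _ <-]; exact: enorm_ge0. Qed.

Lemma edist_le x e : E e -> edist x <= enorm (x - e).
Proof. by move=> Ee; apply: (ge_inf (edist_has_lbound x)); exists e. Qed.

Lemma edist_ge0 x : 0 <= edist x.
Proof.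
apply: lb_le_inf; last by move=> _ [e _ <-]; exact: enorm_ge0.
by have [e Ee] := E0; exists (enorm (x - e)), e.
Qed.

Lemma edist_lip x y : edist x <= edist y + enorm (x - y).
Proof.
rewrite -lerBlDr; apply: lb_le_inf.
  by have [e Ee] := E0; exists (enorm (y - e)), e.
move=> _ [e Ee <-]; rewrite lerBlDr addrC.
by apply: le_trans (edist_le x Ee) _; exact: enorm_dist.
Qed.

Lemma edist_in x : E x -> edist x = 0.
Proof.
move=> Ex; apply/eqP; rewrite eq_le edist_ge0 andbT.
by have := edist_le x Ex; rewrite subrr enorm0.
Qed.

Hypothesis Ecl : closed E.

Lemma edist_gt0 x : ~ E x -> 0 < edist x.
Proof.
move=> Ex; have : nbhs x (~` E) by apply: open_nbhs_nbhs; split=> //; exact: closed_openC.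
move=> /nbhs_ballP[e /= egt0 xe]; apply: (lt_le_trans egt0).
apply: lb_le_inf; first by have [a Ea] := E0; exists (enorm (x - a)), a.
move=> _ [a Ea <-]; rewrite leNgt; apply/negP => xa.
exact: (xe a (ball_enorm egt0 xa) Ea).
Qed.

(** The factor 2 leaves room for an infimum that need not be attained, and still
forces [e = x] when [x] lies in [E]. *)
Lemma near_point x : exists e, E e /\ enorm (x - e) <= 2 * edist x.
Proof.
have [Ex|Ex] := pselect (E x).
  by exists x; rewrite subrr enorm0 edist_in// mulr0.
have dx := edist_gt0 Ex.
have hi : has_inf [set enorm (x - e) | e in E].
  by split; [have [a Ea] := E0; exists (enorm (x - a)), a|exact: edist_has_lbound].
have [_ [e Ee <-] xe] := inf_adherent dx hi.
by exists e; split=> //; rewrite mulr2n mulrDl mul1r ltW.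
Qed.

End DistanceToSet.

(** * Hat functions and elementary Lipschitz estimates *)

Section HatFunction.
Variable R : realType.

Definition hat (t : R) : R := Num.max 0 (1 - `|t|).

Lemma hat_ge0 t : 0 <= hat t.
Proof. by rewrite /hat le_max lexx. Qed.

Lemma hat_le1 t : hat t <= 1.
Proof. by rewrite /hat ge_max ler01/= gerBl normr_ge0. Qed.

Lemma hat_lip t u : `|hat t - hat u| <= `|t - u|.
Proof.
have := ler_dist_dist t u; rewrite /hat !ler_norml => /andP[h1 h2].
by case: (leP 0 (1 - `|t|)); case: (leP 0 (1 - `|u|)) => h3 h4; apply/andP; split; lra.
Qed.

Lemma hat_neq0 t : hat t != 0 -> `|t| < 1.
Proof.
rewrite ltNge; apply: contra => t1; rewrite /hat; apply/eqP/max_idPl.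
by rewrite subr_le0.
Qed.

Lemma hat_out t : 1 <= `|t| -> hat t = 0.
Proof. by move=> t1; apply/max_idPl; rewrite subr_le0. Qed.

Lemma hat_left t : -1 <= t -> t <= 0 -> hat t = 1 + t.
Proof. by move=> t1 t0; rewrite /hat ler0_norm// opprK; apply/max_idPr; lra. Qed.

Lemma hat_right t : 0 <= t -> t <= 1 -> hat t = 1 - t.
Proof. by move=> t0 t1; rewrite /hat ger0_norm//; apply/max_idPr; lra. Qed.

(** Four consecutive integers cover the support for all [t] in an interval of
length 3, so that the same four can be kept while [t] moves by 1 from a point
whose integral part is [m]. *)
Lemma hat_sum (m : int) (t : R) : m%:~R - 1 <= t -> t <= m%:~R + 2 ->
  \sum_(a < 4) hat (t - (m - 1 + (a : nat)%:Z)%:~R) = 1.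
Proof.
move=> h1 h2; rewrite !big_ord_recl big_ord0 /= !intrD.
set z := m%:~R in h1 h2 *; rewrite /bump /= !add1n.
have -> : (-1)%:~R = -1 :> R by [].
have -> : 0%Z%:~R = 0 :> R by [].
have -> : 1%N%:~R = 1 :> R by [].
have -> : 2%N%:~R = 2 :> R by [].
have -> : 3%N%:~R = 3 :> R by [].
have pos (u : R) : 1 <= u -> hat u = 0.
  by move=> u1; apply: hat_out; rewrite ger0_norm//; lra.
have neg (u : R) : u <= -1 -> hat u = 0.
  by move=> u1; apply: hat_out; rewrite ler0_norm; lra.
have [tz|tz] := leP t z.
  rewrite (hat_right (t := t - (z - 1 + 0))); [|lra|lra].
  rewrite (hat_left (t := t - (z - 1 + 1))); [|lra|lra].
  rewrite (neg (t - (z - 1 + 2))); last lra.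
  by rewrite (neg (t - (z - 1 + 3))); lra.
have [tz1|tz1] := leP t (z + 1).
  rewrite (pos (t - (z - 1 + 0))); last lra.
  rewrite (hat_right (t := t - (z - 1 + 1))); [|lra|lra].
  rewrite (hat_left (t := t - (z - 1 + 2))); [|lra|lra].
  by rewrite (neg (t - (z - 1 + 3))); lra.
rewrite (pos (t - (z - 1 + 0))); last lra.
rewrite (pos (t - (z - 1 + 1))); last lra.
rewrite (hat_right (t := t - (z - 1 + 2))); [|lra|lra].
by rewrite (hat_left (t := t - (z - 1 + 3))); lra.
Qed.

Lemma ln_lip (m a b : R) : 0 < m -> m <= a -> m <= b ->
  `|ln a - ln b| <= `|a - b| / m.
Proof.
move=> m0.
wlog ab : a b / b <= a => [hw|] ma mb.
  have [/hw->//|ba] := leP b a.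
  by rewrite distrC [`|a - b|]distrC hw// ltW.
have a0 := lt_le_trans m0 ma; have b0 := lt_le_trans m0 mb.
rewrite !ger0_norm ?subr_ge0//; last by rewrite ler_ln.
rewrite -ln_div ?posrE//.
have -> : a / b = 1 + (a - b) / b by field; rewrite gt_eqF.
apply: (@le_trans _ _ ((a - b) / b)).
  apply: le_ln1Dx; apply: (@lt_le_trans _ _ 0); first by lra.
  by rewrite divr_ge0 ?subr_ge0 ?(ltW b0).
by rewrite ler_wpM2l ?subr_ge0// lef_pV2.
Qed.

Lemma prod_lip (I : Type) (s : seq I) (a b : I -> R) :
  (forall i, 0 <= a i <= 1) -> (forall i, 0 <= b i <= 1) ->
  `|\prod_(i <- s) a i - \prod_(i <- s) b i| <= \sum_(i <- s) `|a i - b i|.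
Proof.
move=> a01 b01.
suff: `|\prod_(i <- s) a i - \prod_(i <- s) b i| <= \sum_(i <- s) `|a i - b i|
   /\ 0 <= \prod_(i <- s) b i <= 1 by case.
elim: s => [|i s [IHs /andP[p0 p1]]].
  by rewrite !big_nil subrr normr0 ler01 !lexx.
have /andP[ai0 ai1] := a01 i; have /andP[bi0 bi1] := b01 i.
rewrite !big_cons; split; last by rewrite mulr_ge0//= mulr_ile1.
set p := \prod_(i <- s) a i in IHs *; set q := \prod_(i <- s) b i in IHs p0 p1 *.
have -> : a i * p - b i * q = (a i - b i) * q + a i * (p - q) by ring.
apply: le_trans (ler_normD _ _) _; rewrite !normrM (ger0_norm p0) (ger0_norm ai0).
by rewrite lerD ?ler_piMr// (le_trans _ IHs)// ler_piMl.
Qed.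

(** From the tangent line bound exp (- 1 / 2) >= 1 / 2. *)
Lemma expR1_le4 : expR (1 : R) <= 4.
Proof.
have h : expR (- (1 / 2)) >= 1 / 2 :> R.
  by have := @expR_ge1Dx R (- (1 / 2)); lra.
have e0 := @expR_gt0 R (1 / 2).
have e2 : expR (1 / 2) <= 2 :> R.
  rewrite expRN in h; rewrite -lef_pV2 ?posrE//.
  by apply: le_trans h; rewrite mul1r.
have -> : expR (1 : R) = expR (1 / 2) * expR (1 / 2).
  by rewrite -expRD; congr expR; lra.
by have := ler_pM (ltW e0) (ltW e0) e2 e2; lra.
Qed.

End HatFunction.

(** * Partition of unity adapted to the distance to a set *)

Lemma floor_bounds (R : realType) (t : R) :
  (Num.floor t)%:~R <= t < (Num.floor t)%:~R + 1.
Proof.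
rewrite floor_le /=; have := lexx (Num.floor t).
by rewrite -ltzD1 floor_lt_int intrD.
Qed.

Section PartitionOfUnity.
Variables (R : realType) (n : nat) (d : 'rV[R]_n -> R).
Hypothesis d_lip : forall x y, d x <= d y + enorm (x - y).

Local Notation index := (int * {ffun 'I_n -> int})%type.
Local Notation offset := ('I_4 * {ffun 'I_n -> 'I_4})%type.

(** An index [(k, p)] is the vertex [expR k * p] of the grid of mesh [expR k]. *)
Definition scale (j : index) : R := expR j.1%:~R.

Definition vertex (j : index) : 'rV[R]_n := \row_i (scale j * (j.2 i)%:~R).

Definition weight (j : index) (z : 'rV[R]_n) : R :=
  hat (ln (d z) - j.1%:~R) *
  \prod_(i < n) hat (z ord0 i / scale j - (j.2 i)%:~R).

Definition window_level (x : 'rV[R]_n) (a : 'I_4) : int :=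
  Num.floor (ln (d x)) - 1 + (a : nat)%:Z.

(** The indices that can have a nonzero weight at some point of the ball of radius
[d x / 16] about [x]: four meshes, and four consecutive grid coordinates in each
direction.  Indexing them by a fixed finite type turns the interpolation into an
ordinary finite sum. *)
Definition window (x : 'rV[R]_n) (o : offset) : index :=
  let k := window_level x o.1 in
  (k, [ffun i => Num.floor (x ord0 i / expR k%:~R) - 1 + (o.2 i : nat)%:Z]).

Lemma scale_gt0 j : 0 < scale j.
Proof. exact: expR_gt0. Qed.

Lemma weight_ge0 j z : 0 <= weight j z.
Proof. by rewrite mulr_ge0 ?hat_ge0// prodr_ge0// => i _; exact: hat_ge0. Qed.

Lemma weight_le1 j z : weight j z <= 1.
Proof.
rewrite mulr_ile1 ?hat_ge0 ?hat_le1 ?prodr_ge0// => [i _|]; first exact: hat_ge0.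
by apply: prodr_ile1 => i _; rewrite hat_ge0 hat_le1.
Qed.

Lemma window_inj x : injective (window x).
Proof.
move=> [a o] [a' o'] [] /addrI /(congr1 absz) /= /val_inj -> h.
congr pair; apply/ffunP => i; apply: val_inj => /=.
by have := congr1 (fun g : {ffun 'I_n -> int} => g i) h; rewrite !ffunE => /addrI [].
Qed.

Lemma int_offset (q k : int) : q - 1 <= k -> k < q + 3 ->
  exists a : 'I_4, k = q - 1 + (a : nat)%:Z.
Proof.
move=> k1 k2; have hk : (absz (k - (q - 1))%R < 4)%N by lia.
by exists (Ordinal hk) => /=; lia.
Qed.

Lemma int_in_window (m k : int) (t u : R) : m = Num.floor t -> `|u - t| <= 1 ->
  `|u - k%:~R| < 1 -> exists a : 'I_4, k = m - 1 + (a : nat)%:Z.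
Proof.
move=> ->; rewrite ler_norml ltr_norml => /andP[h1 h2] /andP[h3 h4].
have /andP[f1 f2] := floor_bounds t.
have k1 : Num.floor t - 1 <= k.
  by rewrite -ltzD1 -(ltr_int R) !intrD; have : (-1)%:~R = -1 :> R by []; lra.
have k2 : k < Num.floor t + 3.
  by rewrite -(ltr_int R) intrD; have : 3%:~R = 3 :> R by []; lra.
exact: int_offset.
Qed.

Lemma window_level_bounds x a : 0 < d x ->
  d x / 16 <= expR (window_level x a)%:~R <= 16 * d x.
Proof.
move=> dx.
have /andP[f1 f2] := floor_bounds (ln (d x)).
have a3 : (a : nat)%:R <= 3 :> R by rewrite ler_nat -ltnS.
have a0 : 0 <= (a : nat)%:R :> R by [].
(* The four levels differ from [ln (d x)] by at most 2. *)
have e16 : expR 2 <= 16 :> R.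
  have -> : expR (2 : R) = expR 1 * expR 1 by rewrite -expRD.
  have e4 := expR1_le4 R; have e0 := @expR_gt0 R 1.
  by have := ler_pM (ltW e0) (ltW e0) e4 e4; lra.
rewrite /window_level !intrD; have -> : (-1)%:~R = -1 :> R by [].
have -> : (a : nat)%:Z%:~R = (a : nat)%:R :> R by [].
set k := _ + _ + _.
have k1 : ln (d x) - 2 <= k by rewrite /k; lra.
have k2 : k <= ln (d x) + 2 by rewrite /k; lra.
apply/andP; split.
  apply: (@le_trans _ _ (expR (ln (d x) - 2))); last by rewrite ler_expR.
  by rewrite expRD lnK ?posrE// ler_wpM2l ?(ltW dx)// expRN lef_pV2 ?posrE ?expR_gt0 ?e16.
apply: (@le_trans _ _ (expR (ln (d x) + 2))); first by rewrite ler_expR.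
by rewrite expRD lnK ?posrE// mulrC ler_wpM2r// ltW.
Qed.

Lemma scale_window x o : 0 < d x ->
  d x / 16 <= scale (window x o) <= 16 * d x.
Proof. exact: window_level_bounds. Qed.

Lemma vertex_window x o : 0 < d x ->
  enorm (x - vertex (window x o)) <= 32 * n%:R * d x.
Proof.
move=> dx; have /andP[_ s1] := scale_window o dx.
set j := window x o in s1 *; have s0 := scale_gt0 j.
apply: le_trans (enorm_le_sum _) _.
have -> : 32 * n%:R * d x = \sum_(i < n) 32 * d x.
  by rewrite sumr_const card_ord -mulr_natl; ring.
apply: ler_sum => i _; rewrite !mxE.
have -> : x ord0 i - scale j * (j.2 i)%:~R =
    scale j * (x ord0 i / scale j - (j.2 i)%:~R) by field; rewrite gt_eqF.
rewrite normrM (gtr0_norm s0).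
suff h : `|x ord0 i / scale j - (j.2 i)%:~R| <= 2.
  have := ler_pM (ltW s0) (normr_ge0 _) s1 h; lra.
rewrite ffunE -/(scale j); set t := x ord0 i / scale j.
have /andP[f1 f2] := floor_bounds t.
have a3 : (o.2 i : nat)%:R <= 3 :> R by rewrite ler_nat -ltnS.
have a0 : 0 <= (o.2 i : nat)%:R :> R by [].
rewrite !intrD; have -> : (-1)%:~R = -1 :> R by [].
have -> : (o.2 i : nat)%:Z%:~R = (o.2 i : nat)%:R :> R by [].
by rewrite ler_norml; apply/andP; split; lra.
Qed.

Section NearPoint.
Variables (x z : 'rV[R]_n).
Hypotheses (dx : 0 < d x) (zx : enorm (z - x) <= d x / 16).

Lemma dist_comparable : 15 / 16 * d x <= d z.
Proof. by have := d_lip x z; rewrite enormBC; have := zx; lra. Qed.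

Lemma dist_variation : `|d z - d x| <= enorm (z - x).
Proof.
have := d_lip x z; have := d_lip z x; rewrite (enormBC x z).
by rewrite ler_norml => h1 h2; apply/andP; split; lra.
Qed.

Lemma ln_dist_variation : `|ln (d z) - ln (d x)| <= 2 * enorm (z - x) / d x.
Proof.
have dx0 := dx; have h := dist_comparable.
have m0 : 0 < d x / 2 by lra.
apply: le_trans (ln_lip m0 _ _) _; [lra|lra|].
have -> : 2 * enorm (z - x) / d x = enorm (z - x) / (d x / 2) by field; rewrite gt_eqF.
by rewrite ler_wpM2r ?invr_ge0 ?(ltW m0)// dist_variation.
Qed.

Lemma ln_dist_variation1 : `|ln (d z) - ln (d x)| <= 1.
Proof.
apply: le_trans ln_dist_variation _; rewrite ler_pdivrMr//.
by have := zx; have := dx; lra.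
Qed.

Lemma coord_variation a i :
  `|z ord0 i / expR (window_level x a)%:~R - x ord0 i / expR (window_level x a)%:~R|
    <= 16 * enorm (z - x) / d x.
Proof.
have /andP[s1 _] := window_level_bounds a dx.
have d0 : 0 < d x / 16 by have := dx; lra.
set s := expR _ in s1 *; have s0 : 0 < s by exact: expR_gt0.
rewrite -mulrBl normrM [`|s^-1|]gtr0_norm ?invr_gt0//.
have -> : 16 * enorm (z - x) / d x = enorm (z - x) * (d x / 16)^-1.
  by field; rewrite gt_eqF.
rewrite ler_pM ?invr_ge0 ?(ltW s0)//; last by rewrite lef_pV2.
by have := coord_le_enorm (z - x) i; rewrite !mxE.
Qed.

Lemma coord_variation1 a i :
  `|z ord0 i / expR (window_level x a)%:~R - x ord0 i / expR (window_level x a)%:~R|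
    <= 1.
Proof.
apply: le_trans (coord_variation a i) _; rewrite ler_pdivrMr//.
by have := zx; lra.
Qed.

(** Within [d x / 16] of [x], the logarithm of the distance and all grid coordinates
move by at most 1, hence stay in reach of the four integers chosen at [x]. *)
Lemma weight_window j : weight j z != 0 -> exists o, window x o = j.
Proof.
rewrite mulf_eq0 negb_or => /andP[/hat_neq0 h1 /prodf_neq0 h2].
have [a ka] := int_in_window erefl ln_dist_variation1 h1.
have h3 i : exists b : 'I_4,
    j.2 i = Num.floor (x ord0 i / scale j) - 1 + (b : nat)%:Z.
  apply: int_in_window erefl _ (hat_neq0 (h2 i isT)).
  by rewrite /scale ka; exact: coord_variation1.
have [b hb] := choice h3.
exists (a, [ffun i => b i]); case: j ka h1 h2 h3 hb => k p /= -> _ _ _ hb.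
by congr pair; apply/ffunP => i; rewrite !ffunE hb.
Qed.

Lemma floor_window (t u : R) : `|u - t| <= 1 ->
  (Num.floor t)%:~R - 1 <= u /\ u <= (Num.floor t)%:~R + 2.
Proof.
rewrite ler_norml => /andP[h1 h2].
have /andP[f1 f2] := floor_bounds t.
split; lra.
Qed.

(** The sum over grid coordinates of a product of hat functions factors into a
product of one-dimensional sums, each equal to 1. *)
Lemma sum_weight : \sum_o weight (window x o) z = 1.
Proof.
rewrite -(pair_bigA _ (fun a b => weight (window x (a, b)) z)) /=.
have [l1 l2] := floor_window ln_dist_variation1.
rewrite -[RHS](hat_sum l1 l2); apply: eq_bigr => a _.
rewrite /weight /scale /= -mulr_sumr -[RHS]mulr1; congr (_ * _).
set s := expR _.
transitivity (\prod_(i < n) \sum_(b < 4)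
    hat (z ord0 i / s - (Num.floor (x ord0 i / s) - 1 + (b : nat)%:Z)%:~R)).
  rewrite bigA_distr_bigA; apply: eq_bigr => b _; apply: eq_bigr => i _.
  by rewrite ffunE.
rewrite big1// => i _.
have [m1 m2] := floor_window (coord_variation1 a i).
exact: hat_sum.
Qed.

Lemma weight_lip o :
  `|weight (window x o) z - weight (window x o) x| <=
    (2 + 16 * n%:R) * enorm (z - x) / d x.
Proof.
rewrite /weight /scale /=; set k := window_level x o.1.
set p := \prod_(i < n) _; set q := \prod_(i < n) _.
have q01 : 0 <= q <= 1.
  rewrite prodr_ge0 => [/=|i _]; last exact: hat_ge0.
  by apply: prodr_ile1 => i _; rewrite hat_ge0 hat_le1.
have pq : `|p - q| <= 16 * n%:R * enorm (z - x) / d x.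
  apply: le_trans (prod_lip _ _ _) _ => [i|i|]; rewrite ?hat_ge0 ?hat_le1//.
  have -> : 16 * n%:R * enorm (z - x) / d x =
      \sum_(i < n) (16 * enorm (z - x) / d x).
    by rewrite sumr_const card_ord -mulr_natl; ring.
  apply: ler_sum => i _; apply: le_trans (hat_lip _ _) _.
  have -> : forall u v w : R, u - w - (v - w) = u - v by move=> *; ring.
  exact: coord_variation.
set a := hat _; set b := hat _.
have ab : `|a - b| <= 2 * enorm (z - x) / d x.
  apply: le_trans (hat_lip _ _) _.
  have -> : forall u v w : R, u - w - (v - w) = u - v by move=> *; ring.
  exact: ln_dist_variation.
have -> : a * p - b * q = a * (p - q) + (a - b) * q by ring.
have /andP[q0 q1] := q01.
apply: le_trans (ler_normD _ _) _; rewrite !normrM (ger0_norm q0).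
rewrite (ger0_norm (hat_ge0 _)).
have h1 : a * `|p - q| <= `|p - q| by rewrite ler_piMl// hat_le1.
have h2 : `|a - b| * q <= `|a - b| by rewrite ler_piMr.
have -> : (2 + 16 * n%:R) * enorm (z - x) / d x =
  2 * enorm (z - x) / d x + 16 * n%:R * enorm (z - x) / d x by ring.
rewrite -/a; lra.
Qed.

End NearPoint.

(** Two windows both containing the support of [h] give the same sum; this
connects the window centred at the point of evaluation with that of a nearby
base point. *)
Lemma sum_window_indep (V : zmodType) (h : index -> V) x z :
  (forall j, h j != 0 -> exists o, window x o = j) ->
  (forall j, h j != 0 -> exists o, window z o = j) ->
  \sum_o h (window x o) = \sum_o h (window z o).
Proof.
move=> hx hz.
have big_supp y : (forall j, h j != 0 -> exists o, window y o = j) ->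
    \sum_o h (window y o) =
    \sum_(j <- [seq j <- map (window y) (enum {: offset}) | h j != 0]) h j.
  move=> hy; rewrite big_filter big_map big_enum_cond /= [RHS]big_mkcond /=.
  by apply: eq_bigr => o _; case: eqP.
rewrite (big_supp x)// (big_supp z)//; apply: perm_big; apply: uniq_perm.
- by rewrite filter_uniq// map_inj_uniq ?enum_uniq//; exact: window_inj.
- by rewrite filter_uniq// map_inj_uniq ?enum_uniq//; exact: window_inj.
- move=> j; rewrite !mem_filter; apply: andb_id2l => hj.
  have mem_window y : (exists w, window y w = j) ->
      j \in map (window y) (enum {: offset}).
    by move=> [w <-]; rewrite map_f ?mem_enum.
  by rewrite !mem_window//; [exact: hz|exact: hx].
Qed.

End PartitionOfUnity.

(** * The extension and its affine family *)

Lemma subrACAB (V : zmodType) (a b c e : V) : a - b - (c - e) = a - c - (b - e).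
Proof. by rewrite !opprB [e - c]addrC [e - b]addrC addrACA. Qed.

Lemma scaler_sub2 (K : pzRingType) (V : lmodType K) (a b : K) (u v : V) :
  a *: u - b *: v = a *: (u - v) + (a - b) *: v.
Proof. by rewrite scalerBr scalerBl subrKA. Qed.

Section Extension.
Variables (R : realType) (n N : nat) (eps : R).
Hypotheses (eps_ge0 : 0 <= eps) (eps_le1 : eps <= 1).
Variables (E : set 'rV[R]_n) (f : 'rV[R]_n -> 'rV[R]_N) (A : affine_family R n N).
Hypothesis AA : almost_affine_with eps f E A.
Hypotheses (E0 : E !=set0) (Ecl : closed E).
Variable np : 'rV[R]_n -> 'rV[R]_n.
Hypothesis np_in : forall x, E (np x).
Hypothesis np_near : forall x, enorm (x - np x) <= 2 * edist E x.

Local Notation d := (edist E).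
Local Notation L x r := (linear_part (A x r)).
Local Notation D x r := (opnorm (linear_part (A x r))).
Local Notation offset := ('I_4 * {ffun 'I_n -> 'I_4})%type.

(** [np x] stands for a chosen almost nearest point of [E] ([np_in], [np_near]). *)
Definition piece j := A (np (vertex R j)) (scale R j).

Definition extension (x : 'rV[R]_n) : 'rV[R]_N :=
  if `[< E x >] then f x
  else \sum_(o : offset) weight d (window d x o) x *: piece (window d x o) x.

(** Over [E], where [np x = x] and [d x = 0], this is [A x r] itself. *)
Definition base x r := A (np x) (Num.max r (d x)).

(** At scales below [d x / 16] the approximation has to be exact at [x] up to an
error proportional to [r], so the base map is translated to agree with the
extension at [x]. *)
Definition extended_family : affine_family R n N := fun x r =>
  if `[< E x >] || (d x / 16 < r) then base x r
  else AffineMap (linear_part (base x r))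
         (extension x - x *m linear_part (base x r)).

(** Large enough for every application of [compare_linear] and [compare_affine]
below; the term in [n] comes from the distance of [x] to the vertices of its
window, see [vertex_window]. *)
Definition comparison_ratio : R := 96 * n%:R + 20.
Local Notation K := comparison_ratio.
Definition linear_cst : R := 8 * K ^+ 3.
Definition lipschitz_cst : R :=
  #|{: offset}|%:R * (linear_cst + (2 + 16 * n%:R) * affine_cst K).
Definition large_scale_cst : R := 32 * linear_cst * (3 * affine_cst K + 7).
Definition extension_cst : R := linear_cst + lipschitz_cst + large_scale_cst.

Lemma comparison_ratio_ge20 : 20 <= K.
Proof. by rewrite /comparison_ratio; have := ler0n R n; lra. Qed.

Lemma comparison_ratio_ge1 : 1 <= K.
Proof. by have := comparison_ratio_ge20; lra. Qed.

Lemma linear_cst_ge1 : 1 <= linear_cst.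
Proof.
rewrite /linear_cst; have := exprn_ege1 3 comparison_ratio_ge1; lra.
Qed.

Lemma affine_cst_ge0 : 0 <= affine_cst K.
Proof.
rewrite /affine_cst; have := comparison_ratio_ge1 => K1; have := sqr_ge0 K => K2.
by rewrite mulr_ge0// mulr_ge0//; lra.
Qed.

Lemma lipschitz_cst_ge0 : 0 <= lipschitz_cst.
Proof.
rewrite mulr_ge0// addr_ge0//; first by have := linear_cst_ge1; lra.
by rewrite mulr_ge0 ?affine_cst_ge0// addr_ge0// mulr_ge0.
Qed.

Lemma large_scale_cst_ge0 : 0 <= large_scale_cst.
Proof.
rewrite /large_scale_cst; have := linear_cst_ge1; have := affine_cst_ge0 => a l.
by rewrite mulr_ge0//; lra.
Qed.

Lemma extension_cst_gt0 : 0 < extension_cst.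
Proof.
rewrite /extension_cst; have := linear_cst_ge1; have := lipschitz_cst_ge0.
by have := large_scale_cst_ge0; lra.
Qed.

Lemma np_on x : E x -> np x = x.
Proof.
move=> Ex; apply/esym/eqP; rewrite -subr_eq0; apply/eqP/enorm_eq0/eqP.
by rewrite eq_le enorm_ge0 andbT; have := np_near x; rewrite (edist_in E0 Ex) mulr0.
Qed.

Lemma np_dist x y : enorm (np x - np y) <= 2 * d x + 2 * d y + enorm (x - y).
Proof.
have := np_near x; have := np_near y.
have := enorm_dist (np x) x (np y); have := enorm_dist x y (np y).
rewrite (enormBC (np x) x); lra.
Qed.

Section Piece.
Variables (x : 'rV[R]_n) (o : offset).
Hypothesis dx : 0 < d x.
Let j := window d x o.

Let scale_lo : d x <= K * scale R j.
Proof.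
have /andP[s1 _] := scale_window o dx; have K20 := comparison_ratio_ge20.
have s0 := scale_gt0 R j.
have : 16 * scale R j <= K * scale R j by rewrite ler_wpM2r ?(ltW s0)//; lra.
by move: s1; rewrite -/j; lra.
Qed.

Let scale_hi : scale R j <= K * d x.
Proof.
have /andP[_ s2] := scale_window o dx; have K20 := comparison_ratio_ge20.
apply: le_trans s2 _; rewrite ler_wpM2r ?(ltW dx)//; lra.
Qed.

Let np_vertex : enorm (np x - np (vertex R j)) <= K * d x.
Proof.
have h1 := np_dist x (vertex R j); have h2 := edist_lip E0 (vertex R j) x.
have h3 := vertex_window o dx; rewrite -/j in h3.
rewrite enormBC in h2.
apply: le_trans h1 _; have dx0 := dx.
have -> : K * d x = 96 * n%:R * d x + 20 * d x by rewrite /comparison_ratio; ring.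
lra.
Qed.

Lemma piece_linear : opnorm (L (np x) (d x) - linear_part (piece j)) <=
  linear_cst * eps * D (np x) (d x).
Proof.
have c := compare_linear eps_ge0 eps_le1 AA comparison_ratio_ge1 (np_in x)
  (np_in (vertex R j)) dx (scale_gt0 R j) scale_lo scale_hi np_vertex.
apply: le_trans (close_dist eps_ge0 linear_cst_ge1 c) _.
by rewrite ler_wpM2r ?opnorm_ge0// ler_wpM2r// gerBl.
Qed.

Lemma piece_affine z : enorm (z - x) <= d x ->
  enorm (piece j z - A (np x) (d x) z) <=
    affine_cst K * eps * D (np x) (d x) * d x.
Proof.
move=> zx; rewrite enormBC.
apply: (compare_affine eps_ge0 eps_le1 AA comparison_ratio_ge1 (np_in x)
  (np_in (vertex R j)) dx (scale_gt0 R j) scale_lo scale_hi np_vertex).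
have h1 := enorm_dist z x (np x); have h2 := np_near x; have dx0 := dx.
have : 20 * d x <= K * d x by rewrite ler_wpM2r ?(ltW dx)// comparison_ratio_ge20.
lra.
Qed.

End Piece.

Lemma extension_on x : E x -> extension x = f x.
Proof. by move=> Ex; rewrite /extension asboolT. Qed.

(** The window of the base point [x] may be used for all nearby points [z]. *)
Lemma extension_local x z : 0 < d x -> enorm (z - x) <= d x / 16 ->
  extension z =
    \sum_(o : offset) weight d (window d x o) z *: piece (window d x o) z.
Proof.
move=> dx zx; have dz : 0 < d z.
  by have := dist_comparable (edist_lip E0) zx; lra.
rewrite /extension asboolF; last by move=> Ez; rewrite (edist_in E0 Ez) ltxx in dz.
pose h j := weight d j z *: piece j z.
have hw j : h j != 0 -> weight d j z != 0.
  by apply: contra => /eqP w0; rewrite /h w0 scale0r.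
apply: (@sum_window_indep R n d _ h z x) => j /hw wj.
  apply: (weight_window (edist_lip E0) dz _ wj).
  by rewrite subrr enorm0 divr_ge0// ltW.
exact: (weight_window (edist_lip E0) dx zx wj).
Qed.

Lemma extension_sub_affine x z (B : affine_map R n N) :
  0 < d x -> enorm (z - x) <= d x / 16 ->
  extension z - B z =
    \sum_(o : offset) weight d (window d x o) z *: (piece (window d x o) z - B z).
Proof.
move=> dx zx; rewrite (extension_local dx zx).
rewrite -[X in _ - X]scale1r -(sum_weight (edist_lip E0) dx zx) scaler_suml -sumrB.
by apply: eq_bigr => o _; rewrite scalerBr.
Qed.

Lemma self_near x : 0 < d x -> enorm (x - x) <= d x / 16.
Proof. by move=> dx; rewrite subrr enorm0 divr_ge0// ltW. Qed.

(** A convex combination of maps that are all close to the base map. *)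
Lemma extension_at_base x : 0 < d x ->
  enorm (extension x - A (np x) (d x) x) <=
    affine_cst K * eps * D (np x) (d x) * d x.
Proof.
move=> dx; rewrite (extension_sub_affine _ dx (self_near dx)).
set c := leRHS; apply: le_trans (enorm_sum _ _ _) _.
rewrite -[c]mul1r -(sum_weight (edist_lip E0) dx (self_near dx)) mulr_suml.
apply: ler_sum => o _; rewrite enormZ ger0_norm ?weight_ge0//.
rewrite ler_wpM2l ?weight_ge0// piece_affine//.
by rewrite subrr enorm0 ltW.
Qed.

(** Since the weights sum to 1 at both points, the base map [B] may be subtracted
from every piece.  The difference of the two sums then splits into the variation
of the pieces, controlled by their linear parts, and the variation of the
weights, of order [|z - x| / d x], multiplied by the distance between the pieces
and [B], of order [eps * opnorm * d x]. *)
Lemma extension_lipschitz x z : 0 < d x -> enorm (z - x) <= d x / 16 ->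
  enorm (extension z - extension x - (z - x) *m L (np x) (d x)) <=
    lipschitz_cst * eps * D (np x) (d x) * enorm (z - x).
Proof.
move=> dx zx; set B := A (np x) (d x).
have e1 : extension z - extension x - (z - x) *m linear_part B =
    (extension z - B z) - (extension x - B x).
  by rewrite -affine_applyB subrACAB.
have ez := extension_sub_affine B dx zx.
have ex := extension_sub_affine B dx (self_near dx).
rewrite (etrans e1 (congr2 (fun u v => u - v) ez ex)) {e1 ez ex}.
rewrite -sumrB; apply: le_trans (enorm_sum _ _ _) _.
pose c := (linear_cst + (2 + 16 * n%:R) * affine_cst K) * eps * opnorm (linear_part B)
   * enorm (z - x).
have -> : lipschitz_cst * eps * opnorm (linear_part B) * enorm (z - x) =
    \sum_(o : offset) c.
  by rewrite sumr_const -mulr_natl /lipschitz_cst /c; ring.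
apply: ler_sum => o _; set j := window d x o; set wz := weight d j z.
set wx := weight d j x.
have -> : wz *: (piece j z - B z) - wx *: (piece j x - B x) =
    wz *: ((z - x) *m (linear_part (piece j) - linear_part B))
    + (wz - wx) *: (piece j x - B x).
  by rewrite scaler_sub2 subrACAB !affine_applyB -mulmxBr.
apply: le_trans (enormD _ _) _; rewrite !enormZ.
have h1 : `|wz| * enorm ((z - x) *m (linear_part (piece j) - linear_part B)) <=
    linear_cst * eps * opnorm (linear_part B) * enorm (z - x).
  apply: (@le_trans _ _ (enorm ((z - x) *m (linear_part (piece j) - linear_part B)))).
    by rewrite ler_piMl ?enorm_ge0// ger0_norm ?weight_ge0// weight_le1.
  apply: le_trans (enorm_mulmx _ _) _; rewrite ler_wpM2r ?enorm_ge0//.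
  by rewrite opnormBC; exact: piece_linear.
have h2 := weight_lip (edist_lip E0) dx zx o; rewrite -/j -/wz -/wx in h2.
have h3 : enorm (piece j x - B x) <= affine_cst K * eps * opnorm (linear_part B) * d x.
  by apply: piece_affine => //; rewrite subrr enorm0 ltW.
have h4 := ler_pM (normr_ge0 _) (enorm_ge0 _) h2 h3.
apply: le_trans (lerD h1 h4) _; rewrite le_eqVlt; apply/orP; left; apply/eqP.
by rewrite /c; field; rewrite gt_eqF.
Qed.

(** Passing from scale [d z] to an arbitrary larger scale [t] is free by
[affine_vertical], because [z] is within [2 * d z] of [np z]. *)
Lemma extension_above_base z t : 0 < t -> d z <= t ->
  enorm (extension z - A (np z) t z) <=
    (2 * affine_cst K + 7) * eps * D (np z) t * t.
Proof.
move=> t0 dzt.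
have a0 := affine_cst_ge0.
have e0 : 0 <= eps * D (np z) t * t by rewrite !mulr_ge0 ?opnorm_ge0 ?(ltW t0).
have [Ez|Ez] := pselect (E z).
  rewrite extension_on// np_on// in e0 *.
  apply: le_trans (almost_affineP AA Ez t0 Ez _) _; first by rewrite subrr enorm0 ltW.
  have -> : (2 * affine_cst K + 7) * eps * D z t * t =
    (2 * affine_cst K + 7) * (eps * D z t * t) by ring.
  by rewrite ler_peMl//; lra.
have dz := edist_gt0 E0 Ecl Ez.
have h1 := extension_at_base dz.
have h2 := affine_vertical eps_ge0 eps_le1 AA (np_in z) dz dzt (np_near z).
have c := close_scale eps_ge0 eps_le1 AA (np_in z) dz dzt.
have t1 : 1 <= 2 * t / d z by rewrite ler_pdivlMr//; lra.
have h3 := close_opnorm eps_ge0 eps_le1 t1 (close_sym c).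
have h4 : affine_cst K * eps * D (np z) (d z) * d z <=
   2 * affine_cst K * eps * D (np z) t * t.
  have -> : 2 * affine_cst K * eps * D (np z) t * t =
    affine_cst K * eps * (2 * t / d z * D (np z) t) * d z by field; rewrite gt_eqF.
  by rewrite ler_wpM2r ?(ltW dz)// ler_wpM2l// mulr_ge0.
apply: le_trans (enorm_dist _ (A (np z) (d z) z) _) _.
have -> : (2 * affine_cst K + 7) * eps * D (np z) t * t =
  2 * affine_cst K * eps * D (np z) t * t + (3 + 2 * 2) * eps * D (np z) t * t by ring.
lra.
Qed.

Lemma extension_large_scale x r z : 0 < r -> d x / 16 <= r -> enorm (z - x) <= r ->
  enorm (extension z - base x r z) <=
    large_scale_cst * eps * opnorm (linear_part (base x r)) * r.
Proof.
move=> r0 dr zx; rewrite /base; set s := Num.max r (d x).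
have rs : r <= s by rewrite le_max lexx.
have ds : d x <= s by rewrite le_max lexx orbT.
have s0 : 0 < s by exact: lt_le_trans rs.
have sr : s <= 16 * r by rewrite ge_max; apply/andP; split; lra.
have dz : d z <= 2 * s by have := edist_lip E0 z x; lra.
have s20 : 0 < 2 * s by lra.
have K20 := comparison_ratio_ge20.
have Ks : 20 * s <= K * s by rewrite ler_wpM2r// ltW.
have l1 := linear_cst_ge1; have a0 := affine_cst_ge0.
have np1 : enorm (np z - np x) <= K * (2 * s).
  by have := np_dist z x; have := edist_ge0 E0 z; have := edist_ge0 E0 x; lra.
have s1 : 2 * s <= K * s by lra.
have s2 : s <= K * (2 * s) by lra.
have zz : enorm (z - np z) <= K * (2 * s) by have := np_near z; lra.
have h1 := extension_above_base s20 dz.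
have h2 := compare_affine eps_ge0 eps_le1 AA comparison_ratio_ge1 (np_in z)
  (np_in x) s20 s0 s1 s2 np1 zz.
have c := compare_linear eps_ge0 eps_le1 AA comparison_ratio_ge1 (np_in z)
  (np_in x) s20 s0 s1 s2 np1.
have h3 := close_opnorm eps_ge0 eps_le1 l1 (close_sym c).
apply: le_trans (enorm_dist _ (A (np z) (2 * s) z) _) _.
apply: le_trans (lerD h1 h2) _.
have -> : (2 * affine_cst K + 7) * eps * D (np z) (2 * s) * (2 * s) +
  affine_cst K * eps * D (np z) (2 * s) * (2 * s) =
  (3 * affine_cst K + 7) * eps * D (np z) (2 * s) * (2 * s) by ring.
have -> : large_scale_cst * eps * D (np x) s * r =
  (3 * affine_cst K + 7) * eps * (linear_cst * D (np x) s) * (2 * (16 * r)).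
  by rewrite /large_scale_cst; ring.
have c0 : 0 <= (3 * affine_cst K + 7) * eps by rewrite mulr_ge0//; lra.
apply: ler_pM; [|lra| |lra]; last exact: ler_wpM2l.
by rewrite mulr_ge0// opnorm_ge0.
Qed.

Lemma extended_family_on x r : E x -> 0 < r -> extended_family x r = A x r.
Proof.
move=> Ex r0; rewrite /extended_family asboolT//= /base np_on// (edist_in E0 Ex).
by congr (A x _); apply/max_idPl; exact: ltW.
Qed.

Lemma linear_part_extended_family x r :
  linear_part (extended_family x r) = L (np x) (Num.max r (d x)).
Proof. by rewrite /extended_family; case: ifP. Qed.

Lemma extension_almost_affine :
  almost_affine_with (extension_cst * eps) extension setT extended_family.
Proof.
have l1 := linear_cst_ge1; have L0 := lipschitz_cst_ge0.
have S0 := large_scale_cst_ge0.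
split=> [x y r s _ _ r0 s0 xy rs|x r _ r0].
  rewrite !linear_part_extended_family.
  set r' := Num.max r (d x); set s' := Num.max s (d y).
  have rr : r <= r' by rewrite le_max lexx.
  have dr : d x <= r' by rewrite le_max lexx orbT.
  have ss : s <= s' by rewrite le_max lexx.
  have ds : d y <= s' by rewrite le_max lexx orbT.
  have r'0 : 0 < r' by exact: lt_le_trans rr.
  have s'0 : 0 < s' by exact: lt_le_trans ss.
  have K20 := comparison_ratio_ge20.
  move: rs; rewrite ler_pdivlMr// ler_pdivrMr// => /andP[rs1 rs2].
  have xy1 : enorm (x - y) <= 2 * r by apply: le_trans xy _; rewrite ge_max; lra.
  have xy2 : enorm (x - y) <= 2 * s by apply: le_trans xy _; rewrite ge_max; lra.
  have d1 := edist_lip E0 x y.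
  have d2 := edist_lip E0 y x; rewrite (enormBC y) in d2.
  have r's' : r' <= 3 * s' by rewrite ge_max; apply/andP; split; lra.
  have s'r' : s' <= 3 * r' by rewrite ge_max; apply/andP; split; lra.
  have Ks : 20 * s' <= K * s' by rewrite ler_wpM2r// ltW.
  have Kr : 20 * r' <= K * r' by rewrite ler_wpM2r// ltW.
  have c : close eps linear_cst (L (np x) r') (L (np y) s').
    apply: (compare_linear eps_ge0 eps_le1 AA comparison_ratio_ge1) => //; try lra.
    by have := np_dist x y; lra.
  apply: le_trans c _; rewrite ler_wpM2r ?le_min ?opnorm_ge0//.
  by rewrite ler_wpM2r// /extension_cst; lra.
apply: ge_ereal_sup => _ [z [_ zx] <-]; rewrite lee_fin.
rewrite linear_part_extended_family; set s := Num.max r (d x).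
have D0 := opnorm_ge0 (L (np x) s).
have e0 : 0 <= eps * D (np x) s * r by rewrite !mulr_ge0// ltW.
have weaken (c : R) : c <= extension_cst ->
    c * eps * D (np x) s * r <= extension_cst * eps * D (np x) s * r.
  move=> cC; rewrite -!mulrA; move: e0; rewrite -!mulrA => e0.
  exact: ler_wpM2r.
rewrite /extended_family; case: ifPn => [c1|].
  have dr : d x / 16 <= r.
    by case/orP: c1 => [/asboolP Ex|/ltW//]; rewrite (edist_in E0 Ex) mul0r ltW.
  apply: le_trans (extension_large_scale r0 dr zx) _; apply: weaken.
  by rewrite /extension_cst; lra.
rewrite negb_or -leNgt => /andP[/asboolPn Ex rd].
have dx := edist_gt0 E0 Ecl Ex.
have sE : s = d x by apply/max_idPr; lra.
have zx' : enorm (z - x) <= d x / 16 by exact: le_trans rd.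
apply: le_trans (weaken lipschitz_cst _); last by rewrite /extension_cst; lra.
have -> : extension z - AffineMap (linear_part (base x r))
     (extension x - x *m linear_part (base x r)) z =
     extension z - extension x - (z - x) *m L (np x) (d x).
  by rewrite /affine_apply /base /= -/s sE mulmxBl [_ *m _ + _]addrCA opprD addrA.
apply: le_trans (extension_lipschitz dx zx') _.
rewrite sE; apply: ler_wpM2l => //.
by apply: mulr_ge0; [exact: mulr_ge0|exact: opnorm_ge0].
Qed.

End Extension.

(** * Weak quasisymmetry of almost affine maps *)

Section WeakQuasisymmetry.
Variables (R : realType) (n N : nat) (delta H rho : R).
Variables (F : 'rV[R]_n -> 'rV[R]_N) (B : affine_family R n N).
Hypotheses (n_gt0 : (0 < n)%N) (delta_ge0 : 0 <= delta) (H1 : 1 <= H).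
Hypotheses (rho_gt1 : 1 < rho) (delta_small : 2 * delta * (1 + rho * H) <= rho - 1).
Hypothesis FB : almost_affine_with delta F setT B.
Local Notation D x r := (opnorm (linear_part (B x r))).
Hypothesis D_gt0 : forall x r, 0 < r -> 0 < D x r.
Hypothesis B_conformal : forall x r (v : 'rV[R]_n), 0 < r ->
  D x r * enorm v <= H * enorm (v *m linear_part (B x r)).

Lemma increment x a r : 0 < r -> enorm (a - x) <= r ->
  enorm (F a - F x - (a - x) *m linear_part (B x r)) <= 2 * delta * D x r * r.
Proof.
move=> r0 ax.
have xx : enorm (x - x) <= r by rewrite subrr enorm0 ltW.
have h1 := almost_affineP FB I r0 I ax.
have h2 := almost_affineP FB I r0 I xx.
have -> : F a - F x - (a - x) *m linear_part (B x r) =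
   (F a - B x r a) - (F x - B x r x).
  by rewrite -affine_applyB; apply/rowP => i; rewrite !mxE; ring.
apply: le_trans (enormB _ _) _.
have -> : 2 * delta * D x r * r = delta * D x r * r + delta * D x r * r by ring.
exact: lerD.
Qed.

Lemma increment_le x a r : 0 < r -> enorm (a - x) <= r ->
  enorm (F a - F x) <= (1 + 2 * delta) * D x r * r.
Proof.
move=> r0 ax; have h := increment r0 ax.
rewrite -[F a - F x](subrK ((a - x) *m linear_part (B x r))).
apply: le_trans (enormD _ _) _.
have h1 := enorm_mulmx (linear_part (B x r)) (a - x).
have h2 := ler_wpM2l (opnorm_ge0 (linear_part (B x r))) ax.
have -> : (1 + 2 * delta) * D x r * r = 2 * delta * D x r * r + D x r * r by ring.
lra.
Qed.

(** Multiplied by [H], so that no division by [H] is needed. *)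
Lemma increment_ge x b : 0 < enorm (b - x) ->
  (1 - 2 * delta * H) * (D x (enorm (b - x)) * enorm (b - x)) <=
  H * enorm (F b - F x).
Proof.
set r := enorm (b - x) => r0; have h := increment r0 (lexx r).
have h1 := B_conformal x (b - x) r0.
have H0 : 0 <= H by have := H1; lra.
have h2 : enorm ((b - x) *m linear_part (B x r)) <=
   enorm (F b - F x) + 2 * delta * D x r * r.
  rewrite -[_ *m _](subKr (F b - F x)).
  by apply: le_trans (enormB _ _) _; rewrite lerD2l.
have h3 := ler_wpM2l H0 h2.
have -> : (1 - 2 * delta * H) * (D x r * r) =
   D x r * r - H * (2 * delta * D x r * r) by ring.
rewrite mulrDr in h3; rewrite -/r in h1; lra.
Qed.

Lemma contraction_factor : 1 + 2 * delta <= rho * (1 - 2 * delta * H).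
Proof.
have -> : rho * (1 - 2 * delta * H) = rho - 2 * delta * (rho * H) by ring.
by have := delta_small; rewrite mulrDr mulr1; lra.
Qed.

Lemma lower_factor_gt0 : 0 < 1 - 2 * delta * H.
Proof.
have := contraction_factor; have := rho_gt1; have := delta_ge0 => d0 r1 h.
have : 0 < rho * (1 - 2 * delta * H) by lra.
by rewrite pmulr_rgt0//; lra.
Qed.

Lemma enorm_gt0 (x y : 'rV[R]_n) : x <> y -> 0 < enorm (x - y).
Proof.
move=> xy; rewrite lt_neqAle enorm_ge0 andbT eq_sym; apply/eqP => /enorm_eq0.
by move/eqP; rewrite subr_eq0 => /eqP.
Qed.

Lemma three_point a b x : enorm (a - x) <= enorm (b - x) ->
  enorm (F a - F x) <= rho * H * enorm (F b - F x).
Proof.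
move=> abx; have [bx|bx] := pselect (b = x).
  have ax : a = x.
    apply/eqP; rewrite -subr_eq0; apply/eqP/enorm_eq0/eqP.
    by rewrite eq_le enorm_ge0 andbT; move: abx; rewrite bx subrr enorm0.
  by rewrite ax bx subrr enorm0 mulr0.
have r0 := enorm_gt0 bx.
have h1 := increment_le r0 abx; have h2 := increment_ge r0.
apply: le_trans h1 _; set p := D x _ in h2 *; set r := enorm (b - x) in r0 h2 *.
have p0 : 0 <= p * r by rewrite mulr_ge0 ?opnorm_ge0 ?ltW.
have h3 := ler_wpM2r p0 contraction_factor.
have rho0 : 0 <= rho by have := rho_gt1; lra.
have h4 := ler_wpM2l rho0 h2.
by rewrite -!mulrA in h3 h4 *; lra.
Qed.

Lemma almost_affine_inj : injective F.
Proof.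
move=> b x Fbx; apply: contrapT => bx; have r0 := enorm_gt0 bx.
have := increment_ge r0; rewrite Fbx subrr enorm0 mulr0; apply/negP; rewrite -ltNge.
by rewrite mulr_gt0 ?lower_factor_gt0// mulr_gt0// D_gt0.
Qed.

Lemma delta_le_half : delta <= 1 / 2.
Proof.
have d0 := delta_ge0; have h1 := H1; have r1 := rho_gt1.
have rH : rho <= rho * H by rewrite ler_peMr//; lra.
have h2 : 2 * delta * (1 + rho) <= 2 * delta * (1 + rho * H).
  by rewrite ler_wpM2l ?mulr_ge0// lerD2l.
have h3 := delta_small.
rewrite leNgt; apply/negP => hd.
have h4 : 1 / 2 * (1 + rho) <= delta * (1 + rho) by rewrite ler_wpM2r// ?ltW//; lra.
by rewrite -mulrA in h2; lra.
Qed.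

(** Halving the scale multiplies the operator norm by at most
[1 + delta <= 3 / 2], so opnorm times scale tends to 0 geometrically. *)
Lemma opnorm_halving x k :
  D x ((1 / 2) ^+ k) * (1 / 2) ^+ k <= (3 / 4) ^+ k * D x 1.
Proof.
elim: k => [|k IHk]; first by rewrite !expr0 mulr1 mul1r.
have p0 : 0 < (1 / 2) ^+ k :> R by rewrite exprn_gt0.
set t := (1 / 2) ^+ k in IHk p0 *.
have ht : (1 / 2) ^+ k.+1 = t / 2 by rewrite exprSr /t; lra.
have t20 : 0 < t / 2 by lra.
have c := @FB.1 x x (t / 2) t I I t20 p0.
rewrite subrr enorm0 le_max (ltW p0) orbT in c; have {}c := c isT.
have tt : 1 / 2 <= t / 2 / t <= 2.
  by rewrite ler_pdivlMr ?ler_pdivrMr//; apply/andP; split; lra.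
have {}c := c tt; have d2 := delta_le_half.
have h1 : D x (t / 2) <= 3 / 2 * D x t.
  rewrite -[linear_part (B x (t / 2))](subrK (linear_part (B x t))).
  apply: le_trans (opnormD _ _) _.
  have h2 : delta * Num.min (D x (t / 2)) (D x t) <= 1 / 2 * D x t.
    by rewrite ler_pM ?delta_ge0// ?le_min ?opnorm_ge0// ge_min lexx orbT.
  by lra.
have h3 := ler_wpM2r (ltW t20) h1.
by rewrite ht exprS -mulrA; lra.
Qed.

(** The oscillation on the ball of radius 2 ^ (- k) is at most twice opnorm times
scale. *)
Lemma almost_affine_continuous : continuous F.
Proof.
move=> x U /nbhs_ballP[e /= e0 eU].
have [k hk] : exists k : nat, 2 * ((3 / 4) ^+ k * D x 1) < e.
  have c0 : 0 < 2 * D x 1 by rewrite mulr_gt0 ?D_gt0.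
  have : (geometric (2 * D x 1) (3 / 4)) n @[n --> \oo] --> (0 : R).
    by apply: cvg_geometric; rewrite ger0_norm; lra.
  move=> /cvgr0_norm_lt /(_ e e0) [k _ hk]; exists k.
  have := hk k (leqnn k); rewrite /= ger0_norm; last first.
    by rewrite mulr_ge0 ?(ltW c0)// exprn_ge0.
  by apply: le_lt_trans; rewrite le_eqVlt; apply/orP; left; apply/eqP; ring.
have p0 : 0 < (1 / 2) ^+ k :> R by rewrite exprn_gt0.
have n0 : 0 < n%:R :> R by rewrite ltr0n.
have eta0 : 0 < (1 / 2) ^+ k / n%:R :> R by rewrite divr_gt0.
apply/nbhs_ballP; exists ((1 / 2) ^+ k / n%:R) => //= y xy.
apply: eU; apply: ball_enorm => //; rewrite enormBC.
have yx : enorm (y - x) <= (1 / 2) ^+ k.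
  rewrite enormBC; apply: le_trans (enorm_ball xy) _.
  by rewrite mulrC mulfVK ?gt_eqF.
apply: le_lt_trans hk; apply: le_trans (increment_le p0 yx) _.
have h := opnorm_halving x k; have d2 := delta_le_half.
rewrite -mulrA; apply: ler_pM => //; last lra.
- by have := delta_ge0; lra.
- by rewrite mulr_ge0 ?opnorm_ge0// ltW.
Qed.

(** The inverse is continuous by the three point condition: with [a] fixed at
distance [e / 2] from [x], a point [w] at distance at least [e] has
[|F w - F x| >= |F a - F x| / (rho H)], a positive bound independent of [w]. *)
Lemma almost_affine_embedding : topological_embedding F.
Proof.
split; first exact: almost_affine_continuous.
pose g y := xget (0 : 'rV[R]_n) [set x | F x = y].
have FK : cancel F g.
  move=> x; apply: almost_affine_inj.
  exact: (@xgetPex _ 0 [set u | F u = F x] (ex_intro _ x erefl)).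
exists g; split=> //; apply/subspace_continuousP => _ [x _ <-] U /nbhs_ballP[e /= e0 eU].
(* Any point at distance [e / 2] will do; this is where [0 < n] is used. *)
pose a : 'rV[R]_n := x + (e / 2) *: delta_mx ord0 (Ordinal n_gt0).
have e20 : 0 < e / 2 by lra.
have ax : enorm (a - x) = e / 2.
  rewrite /a addrC addKr enormZ gtr0_norm// -[RHS]mulr1; congr (_ * _).
  rewrite /enorm (bigD1 (Ordinal n_gt0))//= big1 ?addr0; last first.
    by move=> i /negPf ni; rewrite mxE eqxx ni expr0n.
  by rewrite mxE !eqxx expr1n sqrtr1.
have ax' : a <> x by move=> axe; move: ax; rewrite axe subrr enorm0; lra.
have Fax : 0 < enorm (F a - F x).
  rewrite lt_neqAle enorm_ge0 andbT eq_sym; apply/eqP => /enorm_eq0/eqP.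
  by rewrite subr_eq0 => /eqP/almost_affine_inj.
have rH0 : 0 < rho * H.
  by rewrite mulr_gt0//; [have := rho_gt1; lra|have := H1; lra].
pose c := enorm (F a - F x) / (rho * H).
have c0 : 0 < c by rewrite divr_gt0.
have eta0 : 0 < c / N.+1%:R by rewrite divr_gt0.
have gx : from_subspace (range F) g (F x) = x := FK x.
change (nbhs (F x) [set y | range F y -> U (g y)]).
apply/nbhs_ballP; exists (c / N.+1%:R) => //= y xy [w _ wy].
rewrite -wy in xy *; apply: eU; rewrite gx FK; apply: ball_enorm => //; rewrite enormBC.
have Fwx : enorm (F w - F x) < c.
  rewrite enormBC; apply: le_lt_trans (enorm_ball xy) _.
  by rewrite mulrCA gtr_pMr// ltr_pdivrMr// mul1r ltr_nat.
rewrite ltNge; apply/negP => ewx.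
have awx : enorm (a - x) <= enorm (w - x) by rewrite ax; lra.
have := three_point awx; apply/negP; rewrite -ltNge mulrC -ltr_pdivlMr//.
Qed.

Lemma almost_affine_weakly_quasisymmetric : weakly_quasisymmetric (rho * H) F.
Proof. by split; [exact: almost_affine_embedding|exact: three_point]. Qed.

End WeakQuasisymmetry.

(** * The extension theorem *)

Theorem theorem8p2 (R : realType) (n : nat) (n_ge1 : (1 <= n)%N) :
  exists C1 : R, 0 < C1 /\
  forall H rho : R, 1 <= H -> 1 < rho -> rho <= 2 ->
  exists eps1 : R, 0 < eps1 /\
  forall (N : nat) (E : set 'rV[R]_n) (f : 'rV[R]_n -> 'rV[R]_N)
    (eps : R) (A : affine_family R n N),
  (n <= N)%N ->
  closed E -> E <> setT ->
  (exists x y : 'rV[R]_n, E x /\ E y /\ f x <> f y) ->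
  0 < eps -> eps <= eps1 ->
  almost_affine_with eps f E A ->
  (forall (x : 'rV[R]_n) (r : R), E x -> 0 < r ->
     singval n (linear_part (A x r)) <= H * singval 1 (linear_part (A x r))) ->
  exists (F : 'rV[R]_n -> 'rV[R]_N) (Aplus : affine_family R n N),
    (forall x : 'rV[R]_n, E x -> F x = f x) /\
    almost_affine (C1 * eps) F setT /\
    almost_affine_with (C1 * eps) F setT Aplus /\
    (forall (x : 'rV[R]_n) (r : R), E x -> 0 < r -> Aplus x r = A x r) /\
    weakly_quasisymmetric (rho * H) F /\
    (forall (x : 'rV[R]_n) (r : R), 0 < r ->
       singval n (linear_part (Aplus x r)) <=
         (rho + 1) / 2 * H * singval 1 (linear_part (Aplus x r))).
Proof.
pose C := extension_cst R n; have C0 : 0 < C := extension_cst_gt0 R n.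
exists C; split=> // H rho H1 rho1 rho2.
have rH0 : 0 < 1 + rho * H by rewrite addr_gt0// mulr_gt0//; lra.
have q0 : 0 < 2 * C * (1 + rho * H) by rewrite !mulr_gt0.
(* The second term makes [delta = C * eps] satisfy
   [2 * delta * (1 + rho * H) <= rho - 1]; the first is for the comparisons. *)
exists (Num.min 1 ((rho - 1) / (2 * C * (1 + rho * H)))); split.
  by rewrite lt_min ltr01 divr_gt0//; lra.
move=> N E f eps A _ Ecl _ fE eps0; rewrite le_min => /andP[eps1 eps2] AA conf.
have E0 : E !=set0 by have [x [_ [Ex _]]] := fE; exists x.
have [np np_spec] := choice (near_point E0 Ecl).
have np_in x : E (np x) := (np_spec x).1.
have np_near x : enorm (x - np x) <= 2 * edist E x := (np_spec x).2.
pose F := extension E f A np; pose B := extended_family E f A np.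
have FB : almost_affine_with (C * eps) F setT B.
  have eps_ge0 := ltW eps0.
  exact (extension_almost_affine eps_ge0 eps1 AA E0 Ecl np_in np_near).
have m0 x r : 0 < r -> 0 < Num.max r (edist E x).
  by move=> r0; rewrite lt_max r0.
have BE x r : linear_part (B x r) = linear_part (A (np x) (Num.max r (edist E x))).
  exact: linear_part_extended_family.
exists F, B; split; first by move=> x Ex; exact: extension_on.
split; first by exists B.
split; first exact: FB.
split; first by move=> x r Ex r0; exact: extended_family_on.
split.
  apply: (@almost_affine_weakly_quasisymmetric R n N (C * eps) H rho F B) => //.
  - by rewrite mulr_ge0// ltW.
  - have -> : 2 * (C * eps) * (1 + rho * H) = eps * (2 * C * (1 + rho * H)) by ring.
    by rewrite -ler_pdivlMr.
  - by move=> x r r0; rewrite BE; apply: (opnorm_gt0 (ltW eps0) eps1 AA fE) (m0 _ _ r0).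
  - move=> x r v r0; rewrite BE; apply: opnorm_le_enorm_mulmx => //; first lra.
    exact: conf (m0 _ _ r0).
move=> x r r0; rewrite BE; apply: le_trans (conf _ _ (np_in x) (m0 _ _ r0)) _.
rewrite ler_wpM2r ?singval_ge0// ler_peMl//; lra.
Qed.
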